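(* Assume $f$ is strongly convex: for some $\mu>0$, $f(x)\ge f(y)+\langle\nabla f(y),x-y\rangle+\frac\mu2\|x-y\|^2$ for all $x,y\in X$; and assume the prox-function satisfies $V(x,z)\le\frac12\|x-z\|^2$ for all $x,z\in X$. If $N_0=\left\lceil4\sqrt{2L/(\nu\mu)}\right\rceil$ in the multi-phase stochastic gradient sliding (M-SGS) algorithm, then its iterates satisfy $$\mathbb{E}[\Psi(y_s)-\Psi^*]\le\frac{\Delta_0}{2^s},\qquad s\ge0.$$ As a consequence, the total numbers of evaluations of $\nabla f$ and of $H$ required by the M-SGS algorithm to find a stochastic $\epsilon$-solution (a point $\bar x\in X$ with $\mathbb{E}[\Psi(\bar x)-\Psi^*]\le\epsilon$) can be bounded, respectively, by $$\mathcal{O}\left(\sqrt{\frac{L}{\nu\mu}}\log_2\max\left\{\frac{\Delta_0}{\epsilon},1\right\}\right)$$ and $$\mathcal{O}\left(\frac{M^2+\sigma^2}{\nu\mu\epsilon}+\sqrt{\frac{L}{\nu\mu}}\log_2\max\left\{\frac{\Delta_0}{\epsilon},1\right\}\right).$$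
   Context: Problem. $\|\cdot\|$ is an arbitrary norm on $\mathbb{R}^n$ with dual norm $\|\cdot\|_*$. $X\subseteq\mathbb{R}^n$ is closed and convex, and $\Psi^*=\min_{x\in X}\{\Psi(x):=f(x)+h(x)+\mathcal{X}(x)\}$, where $f,h,\mathcal{X}:X\to\mathbb{R}$ are convex, $\mathcal X$ is simple, $f$ is differentiable, and for constants $L,M>0$, for all $x,y\in X$: $f(x)\le f(y)+\langle\nabla f(y),x-y\rangle+\frac L2\|x-y\|^2$ and $h(x)\le h(y)+\langle h'(y),x-y\rangle+M\|x-y\|$, with $h'(y)\in\partial h(y)$. An optimal solution is assumed to exist. Prox-function. $\omega:X\to\mathbb{R}$ is continuously differentiable with $\langle x-z,\nabla\omega(x)-\nabla\omega(z)\rangle\ge\nu\|x-z\|^2$ for all $x,z\in X$ ($\nu>0$), and $V(x,z)=\omega(z)-[\omega(x)+\langle\nabla\omega(x),z-x\rangle]$. Minimization subproblems below are assumed solvable. Stochastic oracle. At each call with search point $u\in X$ it returns $H(u,\xi)$, where $\xi$ is a fresh random vector, independent of the current and earlier search points and earlier samples, with $\mathbb{E}[H(u,\xi)]=h'(u)\in\partial h(u)$ and $\mathbb{E}[\|H(u,\xi)-h'(u)\|_*^2]\le\sigma^2$ for every $u\in X$. Notation. $l_f(x,y)=f(x)+\langle\nabla f(x),y-x\rangle$. SGS algorithm. Input $x_0\in X$ and $N$; $\bar x_0=x_0$. For $k=1,\dots,N$: set $\underline x_k=(1-\gamma_k)\bar x_{k-1}+\gamma_kx_{k-1}$ and $g_k(\cdot)=l_f(\underline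 x_k,\cdot)$; compute $(x_k,\tilde x_k)=\mathrm{SPS}(g_k,x_{k-1},\beta_k,T_k)$; set $\bar x_k=(1-\gamma_k)\bar x_{k-1}+\gamma_k\tilde x_k$. Output $\bar x_N$. Procedure $\mathrm{SPS}(g,x,\beta,T)$: set $u_0=\tilde u_0=x$; for $t=1,\dots,T$ set $u_t=\arg\min_{u\in X}\{g(u)+\langle H(u_{t-1},\xi_{t-1}),u\rangle+\beta V(x,u)+\beta p_tV(u_{t-1},u)+\mathcal{X}(u)\}$ and $\tilde u_t=(1-\theta_t)\tilde u_{t-1}+\theta_tu_t$; return $(u_T,\tilde u_T)$. M-SGS algorithm. Input: $y_0\in X$, an iteration limit $N_0$, and $\Delta_0$ with $\Psi(y_0)-\Psi^*\le\Delta_0$. For $s=1,2,\dots,S$: run the SGS algorithm with $x_0=y_{s-1}$, $N=N_0$, $p_t=\frac t2$, $\theta_t=\frac{2(t+1)}{t(t+3)}$, $\beta_k=\frac{2L}{\nu k}$, $\gamma_k=\frac2{k+1}$, $T_k=\left\lceil\frac{N_0(M^2+\sigma^2)k^2}{\tilde DL^2}\right\rceil$ where $\tilde D=\frac{\Delta_0}{\nu\mu2^s}$, and let $y_s$ be its output. Output $y_S$. Each run of SGS uses $N_0$ evaluations of $\nabla f$ and $\sum_{k=1}^{N_0}T_k$ evaluations of $H$. The $\mathcal{O}(\cdot)$ bounds mean: there are absolute constants such that, for all sufficiently small $\epsilon>0$ (the threshold may depend on the problem data), one can choose the number of phases $S$ so that $y_S$ is a stochastic $\epsilon$-solution and the numbers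 of evaluations are at most the constants times the displayed expressions. *)

(* Defs.v *)
From mathcomp Require Import all_boot all_order all_algebra.
From mathcomp Require Import all_classical all_reals all_analysis.

Set Implicit Arguments.
Unset Strict Implicit.
Unset Printing Implicit Defensive.

Import Order.TTheory GRing.Theory Num.Theory.
Import numFieldNormedType.Exports.

Local Open Scope classical_set_scope.
Local Open Scope ring_scope.

Section Euclid.
Context {R : realType} {n : nat}.
Implicit Types (x y u v g : 'rV[R]_n) (X : set 'rV[R]_n) (nrm : 'rV[R]_n -> R).

Definition dotp u v : R := \sum_i u 0 i * v 0 i.

Definition is_norm nrm : Prop :=
  [/\ forall x y, nrm (x + y) <= nrm x + nrm y,
      forall (a : R) x, nrm (a *: x) = `|a| * nrm x &
      forall x, nrm x = 0 -> x = 0].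

Definition dual_norm nrm y : R := sup [set dotp y x | x in [set x | nrm x <= 1]].

(** Functions "X -> R" are represented by total functions used on X only, so
    differentiability is relative to X (which may have empty interior, in which
    case [G] is a choice of gradient).  [`|x - y|] is the library's norm on
    row vectors; all norms on R^n give the same notion. *)
Definition gradient_on X (F : 'rV[R]_n -> R) (G : 'rV[R]_n -> 'rV[R]_n) : Prop :=
  forall y, X y -> forall e : R, 0 < e ->
    \forall x \near within X (nbhs y),
      `|F x - F y - dotp (G y) (x - y)| <= e * `|x - y|.

Definition subgradient X (F : 'rV[R]_n -> R) y g : Prop :=
  forall x, X x -> F y + dotp g (x - y) <= F x.

Definition is_argmin X (F : 'rV[R]_n -> R) u : Prop :=
  X u /\ forall v, X v -> F u <= F v.

Definition argmin X (F : 'rV[R]_n -> R) : 'rV[R]_n := xget 0 (is_argmin X F).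

End Euclid.

Definition borel_rV (R : realType) (n : nat) := g_sigma_algebraType (@open 'rV[R]_n).

Definition log2 {R : realType} (x : R) : R := ln x / ln 2.

(** Only ever applied to nonnegative reals. *)
Definition natceil {R : realType} (x : R) : nat := `|Num.ceil x|%N.

Record problem (R : realType) (n : nat) := Problem {
  nrm : 'rV[R]_n -> R;
  feas : set 'rV[R]_n;                (* X *)
  ff : 'rV[R]_n -> R;                 (* f *)
  gradf : 'rV[R]_n -> 'rV[R]_n;       (* nabla f *)
  hh : 'rV[R]_n -> R;                 (* h *)
  subh : 'rV[R]_n -> 'rV[R]_n;        (* h' *)
  chi : 'rV[R]_n -> R;                (* the simple convex term *)
  Lf : R;                             (* L *)
  Mh : R;                             (* M *)
  omega : 'rV[R]_n -> R;
  gradomega : 'rV[R]_n -> 'rV[R]_n;   (* nabla omega *)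
  nu : R }.

Section Problem.
Context {R : realType} {n : nat} (pb : problem R n).
Implicit Types x y z u v q : 'rV[R]_n.

Definition Psi x : R := ff pb x + hh pb x + chi pb x.

Definition lin_f x y : R := ff pb x + dotp (gradf pb x) (y - x).

Definition prox x z : R :=
  omega pb z - (omega pb x + dotp (gradomega pb x) (z - x)).

Record composite_problem : Prop := CompositeProblem {
  nrm_norm : is_norm (nrm pb);
  feas_closed : closed (feas pb);
  feas_convex : @convex_set R 'rV[R]_n (feas pb);
  ff_convex : @convex_function R 'rV[R]_n (feas pb) (ff pb);
  hh_convex : @convex_function R 'rV[R]_n (feas pb) (hh pb);
  chi_convex : @convex_function R 'rV[R]_n (feas pb) (chi pb);
  gradfP : gradient_on (feas pb) (ff pb) (gradf pb);
  Lf_gt0 : 0 < Lf pb;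
  Mh_gt0 : 0 < Mh pb;
  ff_smooth : forall x y, feas pb x -> feas pb y ->
    ff pb x <= ff pb y + dotp (gradf pb y) (x - y)
               + Lf pb / 2 * nrm pb (x - y) ^+ 2;
  subhP : forall y, feas pb y -> subgradient (feas pb) (hh pb) y (subh pb y);
  hh_growth : forall x y, feas pb x -> feas pb y ->
    hh pb x <= hh pb y + dotp (subh pb y) (x - y) + Mh pb * nrm pb (x - y) }.

Record prox_assumptions : Prop := ProxAssumptions {
  gradomegaP : gradient_on (feas pb) (omega pb) (gradomega pb);
  gradomega_continuous : {within feas pb, continuous (gradomega pb)};
  nu_gt0 : 0 < nu pb;
  omega_strong : forall x z, feas pb x -> feas pb z ->
    nu pb * nrm pb (x - z) ^+ 2 <= dotp (x - z) (gradomega pb x - gradomega pb z) }.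

Definition strongly_convex (mu : R) : Prop :=
  forall x y, feas pb x -> feas pb y ->
    ff pb y + dotp (gradf pb y) (x - y) + mu / 2 * nrm pb (x - y) ^+ 2 <= ff pb x.

End Problem.

Section Algorithms.
Context {R : realType} {n : nat} (pb : problem R n).
Context {E : Type} (H : 'rV[R]_n -> E -> 'rV[R]_n).
Implicit Types (x y u v q : 'rV[R]_n).

(** Objective of one SPS step at the prox-centers [x] and [u], where [q] is the
    answer H(u, xi) of the oracle. *)
Definition sps_obj (g : 'rV[R]_n -> R) x (beta pt : R) u q : 'rV[R]_n -> R :=
  fun v => g v + dotp q v + beta * prox pb x v + beta * pt * prox pb u v + chi pb v.

Definition subproblems_solvable : Prop :=
  forall y x u (z : E) (beta pt : R),
    feas pb y -> feas pb x -> feas pb u -> 0 < beta -> 0 < pt ->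
    exists v, is_argmin (feas pb) (sps_obj (lin_f pb y) x beta pt u (H u z)) v.

(** The pair (u_t, ~u_t); [z t] is the sample used at u_t. *)
Fixpoint sps (p theta : nat -> R) (g : 'rV[R]_n -> R) x (beta : R) (z : nat -> E)
    (t : nat) : 'rV[R]_n * 'rV[R]_n :=
  match t with
  | 0%N => (x, x)
  | t'.+1 =>
    let: (u, ut) := sps p theta g x beta z t' in
    let u' := argmin (feas pb) (sps_obj g x beta (p t) u (H u (z t'))) in
    (u', (1 - theta t) *: ut + theta t *: u')
  end.

Definition sgs_under (gamma : nat -> R) (k : nat) (xx : 'rV[R]_n * 'rV[R]_n) :=
  (1 - gamma k) *: xx.2 + gamma k *: xx.1.

(** The pair (x_k, bar x_k); [z k] is the stream of samples of iteration k. *)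
Fixpoint sgs (p theta beta gamma : nat -> R) (T : nat -> nat) (x0 : 'rV[R]_n)
    (z : nat -> nat -> E) (k : nat) : 'rV[R]_n * 'rV[R]_n :=
  match k with
  | 0%N => (x0, x0)
  | k'.+1 =>
    let xx := sgs p theta beta gamma T x0 z k' in
    let: (x, xt) :=
      sps p theta (lin_f pb (sgs_under gamma k xx)) xx.1 (beta k) (z k) (T k) in
    (x, (1 - gamma k) *: xx.2 + gamma k *: xt)
  end.

(** Parameters of the multi-phase method; [t], [k] and [s] start from 1. *)
Definition pp (t : nat) : R := t%:R / 2.
Definition thetat (t : nat) : R := 2 * t.+1%:R / (t%:R * (t%:R + 3)).
Definition betak (k : nat) : R := 2 * Lf pb / (nu pb * k%:R).
Definition gammak (k : nat) : R := 2 / (k%:R + 1).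
Definition Dtilde (mu Delta0 : R) (s : nat) : R := Delta0 / (nu pb * mu * 2 ^+ s).
Definition TT (mu sigma Delta0 : R) (N0 s k : nat) : nat :=
  natceil (N0%:R * (Mh pb ^+ 2 + sigma ^+ 2) * k%:R ^+ 2
           / (Dtilde mu Delta0 s * Lf pb ^+ 2)).

Section Msgs.
Context (mu sigma Delta0 : R) (N0 : nat) (y0 : 'rV[R]_n).
(** [z s k t] is the sample used at the t-th search point of the k-th SGS
    iteration of phase s. *)
Context (z : nat -> nat -> nat -> E).

Let sgs_phase (s : nat) (x0 : 'rV[R]_n) :=
  sgs pp thetat betak gammak (TT mu sigma Delta0 N0 s) x0 (z s).

Fixpoint msgs (s : nat) : 'rV[R]_n :=
  match s with
  | 0%N => y0
  | s'.+1 => (sgs_phase s (msgs s') N0).2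
  end.

(** u_t in the k-th SGS iteration of phase s, for s, k >= 1 and t < T_k. *)
Definition search_point (s k t : nat) : 'rV[R]_n :=
  let xx := sgs_phase s (msgs s.-1) k.-1 in
  (sps pp thetat (lin_f pb (sgs_under gammak k xx)) xx.1 (betak k) (z s k) t).1.

End Msgs.

Definition grad_evals (N0 S : nat) : nat := (\sum_(1 <= s < S.+1) N0)%N.
Definition oracle_evals (mu sigma Delta0 : R) (N0 S : nat) : nat :=
  (\sum_(1 <= s < S.+1) \sum_(1 <= k < N0.+1) TT mu sigma Delta0 N0 s k)%N.

End Algorithms.

Section Oracle.
Context {R : realType} {n : nat} (pb : problem R n).
Context {dE : measure_display} {E : measurableType dE}.
Context {d : measure_display} {Om : measurableType d} (P : probability Om R).

Definition indep_classes (F G : set (set Om)) : Prop :=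
  forall A B, F A -> G B -> P (A `&` B) = (P A * P B)%E.

(** Oracle calls are indexed by triples (s, k, t) and made in lexicographic
    order. *)
Definition call := (nat * nat * nat)%type.

Definition earlier (c c' : call) : bool :=
  let: (s, k, t) := c in let: (s', k', t') := c' in
  (s < s')%N || (s == s') && ((k < k')%N || (k == k') && (t < t')%N).

Definition is_call (N0 : nat) (T : nat -> nat -> nat) (c : call) : bool :=
  let: (s, k, t) := c in [&& (0 < s)%N, (0 < k <= N0)%N & (t < T s k)%N].

Context (calls : set call) (H : 'rV[R]_n -> E -> 'rV[R]_n) (sigma : R).
Context (xi : call -> Om -> E) (search : call -> Om -> 'rV[R]_n).

(** The sigma-algebra generated by the samples of the calls before [c] and by
    the search points up to that of [c]. *)
Definition history (c : call) : set (set Om) :=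
  <<s (\bigcup_(c' in [set c' | calls c' /\ earlier c' c])
         preimage_set_system setT (xi c') measurable)
      `|`
      (\bigcup_(c' in [set c' | calls c' /\ (earlier c' c \/ c' = c)])
         preimage_set_system setT (search c' : Om -> borel_rV R n) measurable) >>.

Record stochastic_oracle : Prop := StochasticOracle {
  oracle_measurable : measurable_fun ((feas pb : set (borel_rV R n)) `*` [set: E])
    (fun uz : borel_rV R n * E => H uz.1 uz.2 : borel_rV R n);
  sample_measurable : forall c, calls c -> measurable_fun setT (xi c);
  search_measurable : forall c, calls c ->
    measurable_fun setT (search c : Om -> borel_rV R n);
  sample_fresh : forall c, calls c ->
    indep_classes (history c) (preimage_set_system setT (xi c) measurable);
  oracle_unbiased : forall c u, calls c -> feas pb u -> forall i,
    ('E_P[fun w => H u (xi c w) 0%R i] = (subh pb u 0%R i)%:E)%E;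
  oracle_variance : forall c u, calls c -> feas pb u ->
    ('E_P[fun w => (dual_norm (nrm pb) (H u (xi c w) - subh pb u) ^+ 2)%R]
       <= (sigma ^+ 2)%:E)%E }.

Definition stochastic_solution (xs : 'rV[R]_n) (eps : R) (Y : Om -> 'rV[R]_n) : Prop :=
  (forall w, feas pb (Y w)) /\
  ('E_P[fun w => (Psi pb (Y w) - Psi pb xs)%R] <= eps%:E)%E.

End Oracle.

(* Main.v *)
(** One prox step of SPS gives a three-point inequality, and with weights t + 1
    these telescope over the inner loop; weighting iteration k by k (k + 1) / 2
    telescopes again over the outer loop, since the coefficients of the prox terms
    are nonincreasing.  So a phase started at x_0 satisfies pointwise
    N (N + 1) / 2 (Psi(bar x_N) - Psi-star) <= 3 L V(x_0, x-star) / nu + noise, where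
    the linear noise terms have mean zero, and the choice of T_k makes the
    quadratic ones contribute at most 4 L Dtilde in mean.  Strong convexity turns
    the gap Delta_0 / 2^s of y_s into V(y_s, x-star) <= Delta_0 / (mu 2^s), and
    N_0^2 >= 32 L / (nu mu) then halves the gap in each phase.

    The noise terms are handled through the law of (search point, sample), which
    is a product measure; h' is measurable on X, being an average of the oracle,
    and the linear terms are integrable because the search points are square
    integrable.  Psi need not be Borel on X, so only the right-hand sides of the
    pointwise bounds are integrated. *)

(* The mean-zero noise terms hide a circularity: such a term has a mean only if it is integrable, so
   its search point needs a second moment, yet that point comes from earlier noisy steps and from
   [gradf], which on a set X with empty interior is only a choice of gradient and need not be
   Lipschitz. The upper quadratic bound on f still controls the variation of the gradient from one
   side along feasible directions, and this suffices to pass second moments from each step to the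
   next.

   T_k grows like k^2 because the inner loop leaves in the weighted gap of iteration k a mean error
   of order k^2 (M^2 + sigma^2) / (L T_k); every iteration then contributes equally, at most 4 L
   Dtilde / N_0.

   For the counts, absolute constants require the ceiling in N_0 to be absorbed by sqrt(L / (nu
   mu)), hence L / (nu mu) >= 1. This follows from comparing upper and lower quadratic bounds at two
   distinct feasible points, so the case where y_0 is the minimizer is treated apart. *)
Require Import Defs.
From HB Require Import structures.
From mathcomp Require Import all_boot all_order all_algebra.
From mathcomp Require Import all_classical all_reals all_analysis.
From mathcomp Require Import measurable_realfun ring lra.

Set Implicit Arguments.
Unset Strict Implicit.
Unset Printing Implicit Defensive.

Import Order.TTheory GRing.Theory Num.Theory.
Import numFieldNormedType.Exports.

Local Open Scope classical_set_scope.
Local Open Scope ring_scope.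

(** * Norms and Borel sets of R^n *)

Section Pairing.
Context {R : realType} {n : nat}.
Implicit Types (x y u v : 'rV[R]_n) (N : 'rV[R]_n -> R).

Lemma dotpC u v : dotp u v = dotp v u.
Proof. by apply: eq_bigr => i _; rewrite mulrC. Qed.

Lemma dotpDl u v x : dotp (u + v) x = dotp u x + dotp v x.
Proof. by rewrite -big_split; apply: eq_bigr => i _; rewrite mxE mulrDl. Qed.

Lemma dotpZl a u x : dotp (a *: u) x = a * dotp u x.
Proof. by rewrite mulr_sumr; apply: eq_bigr => i _; rewrite mxE mulrA. Qed.

Lemma dotpNl u x : dotp (- u) x = - dotp u x.
Proof. by rewrite -scaleN1r dotpZl mulN1r. Qed.

Lemma dotpDr u v x : dotp x (u + v) = dotp x u + dotp x v.
Proof. by rewrite dotpC dotpDl !(dotpC x). Qed.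

Lemma dotpZr a u x : dotp x (a *: u) = a * dotp x u.
Proof. by rewrite dotpC dotpZl dotpC. Qed.

Lemma dotpNr u x : dotp x (- u) = - dotp x u.
Proof. by rewrite dotpC dotpNl dotpC. Qed.

Lemma normr_coord_le (x : 'rV[R]_n) i : `|x 0 i| <= `|x|.
Proof.
rewrite [leRHS]/Num.norm/= mx_normrE.
exact: (@le_bigmax _ _ _ 0 (fun ij : 'I_1 * 'I_n => `|x ij.1 ij.2|) (0, i)).
Qed.

Section Seminorm.
Variable N : 'rV[R]_n -> R.
Hypothesis NT : forall x y, N (x + y) <= N x + N y.
Hypothesis NZ : forall (a : R) x, N (a *: x) = `|a| * N x.

Lemma seminorm0 : N 0 = 0.
Proof. by rewrite -(scale0r 0) NZ normr0 mul0r. Qed.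

Lemma seminormN x : N (- x) = N x.
Proof. by rewrite -scaleN1r NZ normrN1 mul1r. Qed.

Lemma seminormB x y : N (x - y) = N (y - x).
Proof. by rewrite -seminormN opprB. Qed.

Lemma seminorm_ge0 x : 0 <= N x.
Proof.
have := NT x (- x); rewrite subrr seminorm0 seminormN -mulr2n.
by rewrite pmulrn_lge0.
Qed.

Lemma seminorm_triangle y x z : N (x - z) <= N (x - y) + N (y - z).
Proof. by apply: le_trans (NT _ _); rewrite addrA subrK. Qed.

(** Expand x in the standard basis and apply subadditivity term by term. *)
Lemma seminorm_le_sup : exists2 C, 0 <= C & forall x, N x <= C * `|x|.
Proof.
exists (\sum_(i < n) N (delta_mx 0 i)); first by apply: sumr_ge0 => i _; exact: seminorm_ge0.
move=> x; rewrite [in leLHS](row_sum_delta x) mulr_suml.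
suff H : forall r : seq 'I_n, N (\sum_(i <- r) x 0 i *: delta_mx 0 i) <=
    \sum_(i <- r) N (delta_mx 0 i) * `|x|.
  exact: H.
elim=> [|i r IH]; first by rewrite !big_nil seminorm0.
rewrite !big_cons; apply: le_trans (NT _ _) _; apply: lerD => //.
by rewrite NZ mulrC ler_wpM2l ?seminorm_ge0// normr_coord_le.
Qed.

(** Serves twice: for the norm, to minimize it on a compact sphere, and for the dual norm, whose
    Borel measurability comes from continuity. *)
Lemma seminorm_continuous : continuous N.
Proof.
have [C C0 NC] := seminorm_le_sup.
have C1 : 0 < C + 1 by rewrite ltr_wpDl.
move=> x; apply/(@cvgrPdist_lt _ _ _ _ (@nbhs_filter 'rV[R]_n x)) => e e0.
have := @nbhsx_ballx R 'rV[R]_n x _ (divr_gt0 e0 C1).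
rewrite -ball_normE; apply: filterS => y /= xy.
have H : `|N x - N y| <= N (x - y).
  have h1 : N x <= N (x - y) + N y by apply: le_trans (NT _ _); rewrite subrK.
  have h2 : N y <= N (y - x) + N x by apply: le_trans (NT _ _); rewrite subrK.
  rewrite (seminormB y) in h2; rewrite ler_norml; lra.
apply: le_lt_trans H _; apply: le_lt_trans (NC _) _.
apply: (@le_lt_trans _ _ ((C + 1) * `|x - y|)).
  by rewrite ler_wpM2r// lerDl.
by rewrite mulrC -ltr_pdivlMr.
Unshelve. all: by end_near. Qed.

End Seminorm.

(** The other half of norm equivalence: N attains a positive minimum on the unit sphere of the sup
    norm, and C is its inverse. The sphere is empty only in dimension 0. *)
Lemma is_norm_sup_le N : is_norm N -> exists2 C, 0 <= C & forall x, `|x| <= C * N x.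
Proof.
move=> [NT NZ N0].
pose S := [set x : 'rV[R]_n | `|x| = 1].
have [S0|] := pselect (exists x, S x); last first.
  move=> S0; exists 0 => // x; rewrite mul0r.
  have [->|x0] := eqVneq x 0; first by rewrite normr0.
  exfalso; apply: S0; exists (`|x|^-1 *: x).
  by rewrite /S /= normrZ normfV normr_id mulVf// normr_eq0.
have cS : compact S.
  apply: bounded_closed_compact.
    by exists 1; split => // M M1 x /= ->; exact: ltW.
  apply: (@closed_comp _ _ (fun x : 'rV[R]_n => `|x|) [set 1]) => [x _|].
    exact: norm_continuous.
  exact: closed_eq.
have [c Sc cmin] : exists2 c, S c & forall t, S t -> N c <= N t.
  have [c Sc cm] := compact_EVT_min S0 cS (continuous_subspaceT (seminorm_continuous NT NZ)).
  by exists c => [|t St]; [exact: set_mem Sc|apply: cm; exact: mem_set].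
have Nc : 0 < N c.
  rewrite lt_neqAle (seminorm_ge0 NT NZ) andbT eq_sym; apply/eqP => /N0 c0.
  by move: Sc; rewrite /S /= c0 normr0 => /esym/eqP; rewrite oner_eq0.
exists (N c)^-1; first by rewrite invr_ge0 ltW.
move=> x; rewrite mulrC ler_pdivlMr//.
have [->|x0] := eqVneq x 0; first by rewrite normr0 mul0r (seminorm0 NZ).
have := cmin (`|x|^-1 *: x); rewrite NZ normfV normr_id.
rewrite ler_pdivlMl ?normr_gt0//; apply.
by rewrite /S /= normrZ normfV normr_id mulVf// normr_eq0.
Qed.

Section Dual.
Variable N : 'rV[R]_n -> R.
Hypothesis HN : is_norm N.
Let NT : forall x y, N (x + y) <= N x + N y. Proof. by case: HN. Qed.
Let NZ : forall (a : R) x, N (a *: x) = `|a| * N x. Proof. by case: HN. Qed.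

(** [sup] is a default value on unbounded sets, so [dual_norm] is meaningful only once norm
    equivalence has bounded the unit ball. *)
Lemma dual_norm_has_sup y : has_sup [set dotp y x | x in [set x | N x <= 1]].
Proof.
split; first by exists (dotp y 0), 0 => //=; rewrite (seminorm0 NZ).
have [C C0 HC] := is_norm_sup_le HN.
exists (\sum_i `|y 0 i| * C) => _ [x /= x1 <-].
apply: ler_sum => i _; apply: le_trans (ler_norm _) _; rewrite normrM.
apply: ler_wpM2l => //; apply: le_trans (normr_coord_le _ _) _.
by apply: le_trans (HC _) _; rewrite ler_piMr.
Qed.

Lemma dual_norm_ub y x : N x <= 1 -> dotp y x <= dual_norm N y.
Proof. by move=> x1; apply: (ub_le_sup (dual_norm_has_sup y).2); exists x. Qed.

Lemma dual_norm_ge0 y : 0 <= dual_norm N y.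
Proof.
have := @dual_norm_ub y 0; rewrite (seminorm0 NZ) ler01 => /(_ isT).
by rewrite /dotp big1// => i _; rewrite mxE mulr0.
Qed.

Lemma dual_normP y x : dotp y x <= dual_norm N y * N x.
Proof.
have [x0|x0] := eqVneq (N x) 0.
  have -> : x = 0 by case: HN => _ _; apply.
  by rewrite (seminorm0 NZ) mulr0 /dotp big1// => i _; rewrite mxE mulr0.
have Nx : 0 < N x by rewrite lt_neqAle eq_sym x0 (seminorm_ge0 NT NZ).
have := @dual_norm_ub y ((N x)^-1 *: x).
rewrite NZ normfV gtr0_norm// mulVf// lexx => /(_ isT).
by rewrite dotpZr ler_pdivrMl// mulrC.
Qed.

Lemma dual_normD x y : dual_norm N (x + y) <= dual_norm N x + dual_norm N y.
Proof.
apply: sup_le_ub; first by case: (dual_norm_has_sup (x + y)).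
by move=> _ [v v1 <-]; rewrite dotpDl lerD// dual_norm_ub.
Qed.

Lemma dual_normZ (a : R) x : dual_norm N (a *: x) = `|a| * dual_norm N x.
Proof.
have H : forall (b : R) z, dual_norm N (b *: z) <= `|b| * dual_norm N z.
  move=> b z; apply: sup_le_ub; first by case: (dual_norm_has_sup (b *: z)).
  move=> _ [v v1 <-]; rewrite dotpZl.
  have [b0|b0] := leP 0 b.
    by rewrite ger0_norm// ler_wpM2l// dual_norm_ub.
  have := @dual_norm_ub z (- v); rewrite (seminormN NZ) dotpNr => /(_ v1).
  by rewrite ltr0_norm// mulNr -mulrN ler_nM2l// lerNl.
apply/eqP; rewrite eq_le H /=.
have [->|a0] := eqVneq a 0; first by rewrite normr0 mul0r dual_norm_ge0.
rewrite -ler_pdivlMl ?normr_gt0// -normfV.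
by rewrite -[x in leLHS](scalerK a0); exact: H.
Qed.

Lemma dual_norm_continuous : continuous (dual_norm N).
Proof. exact: seminorm_continuous dual_normD dual_normZ. Qed.

End Dual.

End Pairing.

Section BorelVectors.
Context {R : realType} {n : nat}.

Lemma measurable_closed_rV (A : set 'rV[R]_n) :
  closed A -> measurable (A : set (borel_rV R n)).
Proof.
move=> cA; rewrite -(setCK A); apply: measurableC.
by apply: sub_sigma_algebra; exact: closed_openC.
Qed.

Lemma continuous_measurable_rV (f : 'rV[R]_n -> R) :
  continuous f -> measurable_fun setT (f : borel_rV R n -> R).
Proof.
move=> /continuousP cf; apply: (measurability _ (RGenOpens.measurableE R)).
move=> _ [_ [a [b ->] <-]]; rewrite setTI; apply: sub_sigma_algebra.
by apply: cf; exact: interval_open.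
Qed.

Lemma measurable_coord_rV (i : 'I_n) :
  measurable_fun setT (fun x : borel_rV R n => (x : 'rV[R]_n) 0 i).
Proof. by apply: continuous_measurable_rV; exact: coord_continuous. Qed.

(* An open set of R^n is a countable union of rational boxes. *)
Lemma measurable_rV d (T : measurableType d) (f : T -> 'rV[R]_n) :
  (forall i, measurable_fun setT (fun w => f w 0 i)) ->
  measurable_fun setT (f : T -> borel_rV R n).
Proof.
move=> mf; apply: (@measurability _ _ _ (borel_rV R n) _ _ (@open 'rV[R]_n)) => //.
move=> _ [U oU <-]; rewrite setTI.
pose box (c : 'rV[rat]_n * rat) := [set x : 'rV[R]_n |
  forall i, ratr (c.1 0 i) - ratr c.2 < x 0 i < ratr (c.1 0 i) + ratr c.2].
pose I := [set c | box c `<=` U].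
have -> : f @^-1` U = \bigcup_(c in I) (f @^-1` box c).
  rewrite predeqE => w; split; last by move=> [c cI] /cI.
  move=> Uw; move: oU; rewrite openE => /(_ _ Uw); rewrite /interior.
  case/(@nbhs_ballP R 'rV[R]_n (f w) U) => e /= e0 eU.
  (* A box of half-width q whose center is within q of the point lies in the ball of radius 2q,
     hence of radius e. *)
  have [q /andP[q0 qe]] : exists q : rat, 0 < (ratr q : R) < e / 2.
    have e20 : 0 < e / 2 by rewrite divr_gt0.
    by have [q] := rat_in_itvoo e20; rewrite in_itv/= => ?; exists q.
  have H i : {p : rat | (ratr p : R) - ratr q < f w 0 i < ratr p + ratr q}.
    have fq : f w 0 i - ratr q < f w 0 i + ratr q by lra.
    have /cid[p] := rat_in_itvoo fq; rewrite in_itv/= => /andP[h1 h2].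
    by exists p; lra.
  exists (\row_i sval (H i), q); last first.
    by move=> i /=; rewrite mxE; exact: svalP (H i).
  move=> x /= bx; apply: eU; split => // j i.
  have := bx i; rewrite /= mxE => /andP[h1 h2].
  have /andP[h3 h4] := svalP (H i).
  rewrite (ord1 j) /ball/= ltr_norml; lra.
rewrite bigcup_mkcond; apply: countable_bigcupT_measurable => // c; case: ifP => // _.
have -> : f @^-1` box c = \big[setI/setT]_(i < n)
   ((fun w => f w 0 i) @^-1` `]ratr (c.1 0 i) - ratr c.2, ratr (c.1 0 i) + ratr c.2[).
  rewrite predeqE => w; rewrite -bigcap_seq; split => /= [h i _|h i].
    by rewrite /= in_itv/=; exact: h.
  by have := h i; rewrite /= in_itv/=; apply; rewrite mem_index_enum.
apply: bigsetI_measurable => i _; rewrite -[X in measurable X]setTI.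
by apply: mf => //; exact: measurable_itv.
Qed.

End BorelVectors.

(** * First-order conditions on a convex set *)

Section FirstOrder.
Context {R : realType} {n : nat}.
Implicit Types (X : set 'rV[R]_n) (F : 'rV[R]_n -> R) (G : 'rV[R]_n -> 'rV[R]_n).

Lemma convex_setE X (t : R) x y : @convex_set R 'rV[R]_n X -> X x -> X y ->
  0 <= t <= 1 -> X ((1 - t) *: x + t *: y).
Proof.
move=> cX Xx Xy /andP[t0 t1].
have := cX y x (Itv01 t0 t1) (mem_set Xy) (mem_set Xx).
by rewrite inE addrC.
Qed.

Lemma convex_functionE X F (t : R) x y : @convex_function R 'rV[R]_n X F ->
  X x -> X y -> 0 <= t <= 1 ->
  F ((1 - t) *: x + t *: y) <= (1 - t) * F x + t * F y.
Proof.
move=> cF Xx Xy /andP[t0 t1].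
have := cF (Itv01 t0 t1) y x (mem_set Xy) (mem_set Xx).
rewrite [(1 - t) *: x + _]addrC [(1 - t) * _ + _]addrC; exact.
Qed.

Lemma segmentE (t : R) (x z : 'rV[R]_n) : (1 - t) *: x + t *: z = x + t *: (z - x).
Proof. by apply/rowP => i; rewrite !mxE; ring. Qed.

Lemma gradient_on_segment X F G x z (t e : R) : @convex_set R 'rV[R]_n X ->
  gradient_on X F G -> X x -> X z -> 0 <= t <= 1 -> 0 < e ->
  exists2 r : R, 0 < r & forall s, 0 <= s <= 1 -> `|s - t| < r ->
    `|F (x + s *: (z - x)) - F (x + t *: (z - x))
      - dotp (G (x + t *: (z - x))) (z - x) * (s - t)| <= e * `|s - t|.
Proof.
move=> cX gF Xx Xz t01 e0.
have XX s : 0 <= s <= 1 -> X (x + s *: (z - x)).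
  by move=> s01; rewrite -segmentE; exact: convex_setE.
(* The added 1 covers the degenerate segment z = x. *)
have C0 : 0 < `|z - x| + 1 by rewrite ltr_wpDl.
have eC : 0 < e / (`|z - x| + 1) by rewrite divr_gt0.
have := gF _ (XX _ t01) _ eC.
case/(@nbhs_ballP R 'rV[R]_n) => r /= r0 H.
exists (r / (`|z - x| + 1)); first by rewrite divr_gt0.
move=> s s01 sr.
have E : x + s *: (z - x) - (x + t *: (z - x)) = (s - t) *: (z - x).
  by rewrite opprD addrACA subrr add0r scalerBl.
have := H (x + s *: (z - x)).
rewrite -ball_normE /= -normrN opprB E normrZ.
rewrite dotpZr [(s - t) * _]mulrC => H1.
apply: le_trans (H1 _ (XX _ s01)) _.
  rewrite ltr_pdivlMr// in sr; apply: le_lt_trans sr.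
  by rewrite ler_wpM2l// lerDl.
rewrite mulrCA mulrC ler_wpM2r//  mulrAC ler_pdivrMr// ler_wpM2l// ?lerDl//.
exact: ltW.
Qed.

(** A gradient relative to X gives only one-sided information at the ends of a segment. The mean
    value theorem asks there only for continuity, and at interior points the relative derivative is
    an ordinary one. *)
Lemma relative_derivative_ge0_le (F dF : R -> R) :
  (forall t e, 0 <= t <= 1 -> 0 < e -> exists2 r : R, 0 < r &
    forall s, 0 <= s <= 1 -> `|s - t| < r ->
      `|F s - F t - dF t * (s - t)| <= e * `|s - t|) ->
  (forall t, 0 <= t <= 1 -> 0 <= dF t) -> F 0 <= F 1.
Proof.
move=> dFP dF0.
have [c c01 E] : exists2 c, c \in `[0, 1]%R & F 1 - F 0 = dF c * (1 - 0).
  apply: MVT_segment => //.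
    move=> t; rewrite in_itv/= => /andP[t0 t1].
    have L : (fun h : R => h^-1 *: (F (h *: 1 + t) - F t)) @ 0^' --> dF t.
      apply/cvgrPdist_le => e e0.
      have [r r0 H] := dFP t e (introT andP (conj (ltW t0) (ltW t1))) e0.
      near=> h.
      have h0 : h != 0 by near: h; exact: nbhs_dnbhs_neq.
      have hr : `|h| < Num.min r (Num.min t (1 - t)).
        by near: h; apply: dnbhs0_lt; rewrite !lt_min r0 t0 subr_gt0.
      move: hr; rewrite !lt_min => /and3P[hr ht ht'].
      move: ht ht'; rewrite !ltr_norml => /andP[ht1 ht2] /andP[ht3 ht4].
      have := H (h + t); rewrite addrK => /(_ _ hr) H1.
      have {}H1 : `|F (h + t) - F t - dF t * h| <= e * `|h| by apply: H1; lra.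
      rewrite [h *: _]mulr1.
      rewrite (_ : dF t - _ = - (h^-1 * (F (h + t) - F t - dF t * h))); last first.
        rewrite /GRing.scale/=; set A := F _ - _.
        by rewrite [in RHS]mulrBr [h^-1 * (_ * h)]mulrCA mulVf// mulr1 opprB.
      by rewrite normrN normrM normfV ler_pdivrMl ?normr_gt0// [`|h| * e]mulrC.
    have D : derivable F t 1 by exact: (cvgP (dF t) L).
    by split=> //; exact: cvg_lim L.
  apply/subspace_continuousP => t; rewrite /= in_itv/= => t01.
  apply/cvgrPdist_le => e e0.
  have [r r0 H] := dFP t 1 t01 ltr01.
  have C0 : 0 < `|dF t| + 1 by rewrite ltr_wpDl.
  near=> s.
  have s01 : 0 <= s <= 1.
    by near: s; rewrite near_withinE; apply: nearW => s'; rewrite /= in_itv.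
  have sr : `|t - s| < Num.min r (e / (`|dF t| + 1)).
    near: s; apply: cvg_within.
    have d0 : 0 < Num.min r (e / (`|dF t| + 1)) by rewrite lt_min r0 divr_gt0.
    by have := @nbhsx_ballx R R^o t _ d0; rewrite -ball_normE.
  rewrite lt_min distrC in sr; case/andP: sr => sr se.
  have := H s s01 sr; rewrite mul1r => H1.
  rewrite ltr_pdivlMr// in se.
  rewrite distrC (_ : F s - F t = (F s - F t - dF t * (s - t)) + dF t * (s - t)); last by ring.
  apply: le_trans (ler_normD _ _) _; rewrite normrM.
  by apply: le_trans (ltW se); rewrite [leRHS]mulrDr mulr1 [leRHS]addrC [`|_| * `|_|]mulrC lerD2r.
move: c01; rewrite in_itv/= => /dF0; lra.
Unshelve. all: by end_near. Qed.

(* Compare a minimizer u with u + s(v - u) and let s tend to 0. *)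
Lemma argmin_first_order X phi F G (a : R) u v : @convex_set R 'rV[R]_n X ->
  (forall t x y, X x -> X y -> 0 <= t <= 1 ->
    phi ((1 - t) *: x + t *: y) <= (1 - t) * phi x + t * phi y) ->
  gradient_on X F G -> 0 <= a ->
  is_argmin X (fun w => phi w + a * F w) u -> X v ->
  phi u <= phi v + a * dotp (G u) (v - u).
Proof.
move=> cX cphi gF a0 [Xu umin] Xv; rewrite leNgt; apply/negP => lt.
set g := dotp _ _ in lt.
pose D := phi u - (phi v + a * g).
have D0 : 0 < D by rewrite subr_gt0.
have a1 : 0 < 2 * (a + 1) by rewrite mulr_gt0// ltr_wpDl.
(* D is the defect to be refuted. With this tolerance the differentiation error of a F stays
   strictly below D s, so a short move towards v would beat the minimizer. *)
have e0 : 0 < D / (2 * (a + 1)) by rewrite divr_gt0.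
have t01 : 0 <= (0 : R) <= 1 by rewrite lexx ler01.
have [r r0] := gradient_on_segment cX gF Xu Xv t01 e0.
rewrite !scale0r !addr0 -/g => H.
pose s := Num.min 1 (r / 2).
have s0 : 0 < s by rewrite lt_min ltr01 divr_gt0.
have s1 : s <= 1 by rewrite ge_min lexx.
have sr : s < r.
  by apply: (@le_lt_trans _ _ (r / 2)); [rewrite ge_min lexx orbT|lra].
have s01 : 0 <= s <= 1 by rewrite ltW.
have := H s s01; rewrite subr0 gtr0_norm// => /(_ sr).
rewrite ler_norml => /andP[_ h1].
have h2 := cphi s u v Xu Xv s01.
have h3 := umin _ (convex_setE cX Xu Xv s01).
rewrite segmentE in h2 h3.
set w := u + _ in h1 h2 h3.
have h4 : F w <= F u + g * s + D / (2 * (a + 1)) * s by lra.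
have h5 : a * F w <= a * (F u + g * s + D / (2 * (a + 1)) * s) by rewrite ler_wpM2l.
have h6 : a * (D / (2 * (a + 1))) < D.
  rewrite mulrA ltr_pdivrMr//; nra.
have h7 : a * (D / (2 * (a + 1))) * s < D * s by rewrite ltr_pM2r.
rewrite /D in h7 h5; nra.
Qed.

End FirstOrder.

(** * Deterministic analysis of gradient sliding *)

Section Composite.
Context {R : realType} {n : nat} (pb : problem R n).
Hypothesis HC : composite_problem pb.
Hypothesis HP : prox_assumptions pb.
Implicit Types x y z u v q : 'rV[R]_n.
Local Notation X := (feas pb).
Local Notation N := (nrm pb).
Local Notation V := (prox pb).
Local Notation dual := (dual_norm (nrm pb)).

Lemma nrmD x y : N (x + y) <= N x + N y.
Proof. by case: (nrm_norm HC). Qed.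

Lemma nrmZ (a : R) x : N (a *: x) = `|a| * N x.
Proof. by case: (nrm_norm HC). Qed.

Lemma nrm_ge0 x : 0 <= N x.
Proof. exact: seminorm_ge0 nrmD nrmZ x. Qed.

Lemma nrmB x y : N (x - y) = N (y - x).
Proof. exact: seminormB nrmZ x y. Qed.

Lemma nrm_triangle y x z : N (x - z) <= N (x - y) + N (y - z).
Proof. exact: (seminorm_triangle nrmD). Qed.

Lemma feas_conv (t : R) x y : X x -> X y -> 0 <= t <= 1 ->
  X ((1 - t) *: x + t *: y).
Proof. by move=> *; apply: convex_setE => //; exact: feas_convex HC. Qed.

(** Along the segment from x to z, subtract from omega its tangent at x and the quadratic K t^2 / 2.
    The slope of the rest at t is nonnegative: it is strong monotonicity between x + t d and x,
    divided by t. *)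
Lemma prox_lower x z : X x -> X z -> nu pb / 2 * N (x - z) ^+ 2 <= V x z.
Proof.
move=> Xx Xz; rewrite nrmB; set d := z - x; set K := nu pb * N d ^+ 2.
have nu0 := nu_gt0 HP.
have K0 : 0 <= K by rewrite mulr_ge0 ?sqr_ge0// ltW.
pose g := dotp (gradomega pb x) d.
pose F (t : R) := omega pb (x + t *: d) - g * t - K / 2 * t ^+ 2.
pose dF (t : R) := dotp (gradomega pb (x + t *: d)) d - g - K * t.
suff : F 0 <= F 1.
  rewrite /F /prox scale0r scale1r addr0 -/d -/g (_ : x + d = z) /K; last by rewrite addrC subrK.
  lra.
have Xt t : 0 <= t <= 1 -> X (x + t *: d).
  by move=> t01; rewrite -segmentE; exact: feas_conv.
apply: (@relative_derivative_ge0_le _ F dF) => [t e t01 e0|t t01].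
  have e2 : 0 < e / 2 by rewrite divr_gt0.
  have [r r0 H] := gradient_on_segment (feas_convex HC) (gradomegaP HP) Xx Xz t01 e2.
  have K1 : 0 < K + 1 by rewrite ltr_wpDl.
  (* Half of e pays for the derivative of omega; the second bound on the radius makes the remainder
     K (s - t)^2 / 2 fit in the other half. *)
  exists (Num.min r (e / (K + 1))); first by rewrite lt_min r0 divr_gt0.
  move=> s s01; rewrite lt_min => /andP[sr se].
  have := H s s01 sr; rewrite -/d.
  set G := dotp _ _.
  rewrite (_ : F s - F t - dF t * (s - t) =
    (omega pb (x + s *: d) - omega pb (x + t *: d) - G * (s - t))
      - K / 2 * (`|s - t| ^+ 2)); last first.
    by rewrite real_normK ?num_real// /F /dF -/G; field.
  rewrite ltr_pdivlMr// in se.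
  set A := omega _ _ - _ - _; set a := `|s - t| in se *.
  have a0 : 0 <= a by exact: normr_ge0.
  move=> Ale; apply: le_trans (ler_normB _ _) _.
  rewrite [`|K / 2 * _|]ger0_norm; last by rewrite mulr_ge0 ?sqr_ge0// divr_ge0.
  have : K / 2 * a ^+ 2 <= e / 2 * a.
    rewrite expr2 mulrA ler_wpM2r//; nra.
  lra.
rewrite /dF.
have [->|t0] := eqVneq t 0; first by rewrite scale0r addr0 /g mulr0; lra.
have tp : 0 < t by case/andP: t01 => ? _; rewrite lt_neqAle eq_sym t0.
have := omega_strong HP (Xt _ t01) Xx.
rewrite addrAC subrr add0r nrmZ dotpZl dotpDr dotpNr ![dotp d _]dotpC -/g.
rewrite gtr0_norm// => h.
have {}h : t * (K * t) <= t * (dotp (gradomega pb (x + t *: d)) d - g).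
  by apply: le_trans h; rewrite /K; lra.
by rewrite ler_pM2l// in h; lra.
Qed.

Lemma prox_ge0 x z : X x -> X z -> 0 <= V x z.
Proof.
move=> Xx Xz; apply: le_trans (prox_lower Xx Xz).
by rewrite mulr_ge0 ?sqr_ge0// divr_ge0// ltW// (nu_gt0 HP).
Qed.

(** Average the two tangent inequalities at the intermediate point; the linear parts cancel. This is
    how convexity of omega is obtained from the nonnegativity of [prox]. *)
Lemma convex_of_tangent (F : 'rV[R]_n -> R) (G : 'rV[R]_n -> 'rV[R]_n) (t : R) x y :
  (forall a b, X a -> X b -> F a + dotp (G a) (b - a) <= F b) ->
  X x -> X y -> 0 <= t <= 1 ->
  F ((1 - t) *: x + t *: y) <= (1 - t) * F x + t * F y.
Proof.
move=> H Xx Xy t01; have Xc := feas_conv Xx Xy t01; set c := _ + _ in Xc *.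
have h1 := H _ _ Xc Xx; have h2 := H _ _ Xc Xy.
case/andP: (t01) => t0 t1.
have E : (1 - t) * dotp (G c) (x - c) + t * dotp (G c) (y - c) = 0.
  rewrite -!dotpZr -dotpDr (_ : _ + _ = 0 :> 'rV_n); first by rewrite -(scale0r 0) dotpZr mul0r.
  by apply/rowP => i; rewrite !mxE; ring.
have h3 := ler_wpM2l t0 h2.
have h4 : (1 - t) * (F c + dotp (G c) (x - c)) <= (1 - t) * F x.
  by rewrite ler_wpM2l// subr_ge0.
lra.
Qed.

Lemma omega_tangent x z : X x -> X z ->
  omega pb x + dotp (gradomega pb x) (z - x) <= omega pb z.
Proof. by move=> Xx Xz; have := prox_ge0 Xx Xz; rewrite /prox subr_ge0. Qed.

Lemma dotp_conv (t : R) g x y z :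
  dotp g ((1 - t) *: x + t *: y - z) = (1 - t) * dotp g (x - z) + t * dotp g (y - z).
Proof. by rewrite -!dotpZr -dotpDr; congr dotp; apply/rowP => i; rewrite !mxE; ring. Qed.

Lemma prox_convex (t : R) z x y : X x -> X y -> 0 <= t <= 1 ->
  V z ((1 - t) *: x + t *: y) <= (1 - t) * V z x + t * V z y.
Proof.
move=> Xx Xy t01; have := convex_of_tangent omega_tangent Xx Xy t01.
rewrite /prox dotp_conv; lra.
Qed.

Lemma hh_conv (t : R) x y : X x -> X y -> 0 <= t <= 1 ->
  hh pb ((1 - t) *: x + t *: y) <= (1 - t) * hh pb x + t * hh pb y.
Proof. by apply: convex_functionE; exact: hh_convex HC. Qed.

Lemma chi_conv (t : R) x y : X x -> X y -> 0 <= t <= 1 ->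
  chi pb ((1 - t) *: x + t *: y) <= (1 - t) * chi pb x + t * chi pb y.
Proof. by apply: convex_functionE; exact: chi_convex HC. Qed.

Lemma lin_f_conv (t : R) a x y :
  lin_f pb a ((1 - t) *: x + t *: y) = (1 - t) * lin_f pb a x + t * lin_f pb a y.
Proof. by rewrite /lin_f dotp_conv; ring. Qed.

(** The objective is an affine function plus chi plus beta (1 + p) omega. Linearizing only the omega
    part at the minimizer w leaves exactly that multiple of V(w, v). *)
Lemma sps_three_point a x (beta p : R) u q w v :
  X x -> X u -> 0 < beta -> 0 < p ->
  is_argmin X (sps_obj pb (lin_f pb a) x beta p u q) w -> X v ->
  sps_obj pb (lin_f pb a) x beta p u q w + beta * (1 + p) * V w v <=
  sps_obj pb (lin_f pb a) x beta p u q v.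
Proof.
move=> Xx Xu b0 p0 am Xv.
pose phi w := lin_f pb a w + dotp q w
  - beta * (omega pb x + dotp (gradomega pb x) (w - x))
  - beta * p * (omega pb u + dotp (gradomega pb u) (w - u)) + chi pb w.
pose al := beta * (1 + p).
have al0 : 0 <= al by rewrite mulr_ge0 ?ltW// addr_gt0.
have E : sps_obj pb (lin_f pb a) x beta p u q = fun w => phi w + al * omega pb w.
  by apply/funext => y; rewrite /sps_obj /phi /prox /al; ring.
rewrite E in am *.
have := argmin_first_order (feas_convex HC) _ (gradomegaP HP) al0 am Xv.
rewrite -/al /prox => H; suff : phi w <= phi v + al * dotp (gradomega pb w) (v - w) by lra.
apply: H => t y z Xy Xz t01.
have := chi_conv Xy Xz t01.
have E2 b : dotp b ((1 - t) *: y + t *: z) = (1 - t) * dotp b y + t * dotp b z.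
  by rewrite dotpDr !dotpZr.
rewrite /phi lin_f_conv !dotp_conv E2; lra.
Qed.

(** The function that the inner loop minimizes approximately: f is linearized, while h appears
    exactly instead of through oracle answers. *)
Definition sps_value a x (beta : R) w := lin_f pb a w + hh pb w + chi pb w + beta * V x w.

Lemma sps_value_conv a x (beta t : R) y z : 0 < beta -> X y -> X z ->
  0 <= t <= 1 ->
  sps_value a x beta ((1 - t) *: y + t *: z) <=
  (1 - t) * sps_value a x beta y + t * sps_value a x beta z.
Proof.
move=> b0 Xy Xz t01; rewrite /sps_value lin_f_conv.
have := chi_conv Xy Xz t01; have := hh_conv Xy Xz t01.
have := ler_wpM2l (ltW b0) (prox_convex x Xy Xz t01).
lra.
Qed.

Lemma dual_pair q u v : dotp q (u - v) <= dual q * N (u - v).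
Proof. exact: dual_normP (nrm_norm HC) _ _. Qed.

(** The oracle answer is exchanged for h by the growth bound at the new point w and the subgradient
    inequality at v. The price, M plus the dual norm of the noise, times N(w - u), is paid by the
    prox term beta p V(u, w). *)
Lemma sps_step a x (beta p : R) u q w v :
  X x -> X u -> 0 < beta -> 0 < p ->
  is_argmin X (sps_obj pb (lin_f pb a) x beta p u q) w -> X v ->
  sps_value a x beta w + beta * (1 + p) * V w v <=
  sps_value a x beta v + beta * p * V u v + dotp (q - subh pb u) (v - u)
    + (Mh pb + dual (q - subh pb u)) ^+ 2 / (2 * nu pb * beta * p).
Proof.
move=> Xx Xu b0 p0 am Xv.
have nu0 := nu_gt0 HP.
have Xw : X w by case: am.
have h1 := sps_three_point Xx Xu b0 p0 am Xv.
have h2 := hh_growth HC Xw Xu.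
have h3 := subhP HC Xu Xv.
set de := q - subh pb u; set r := N (w - u).
have h4 : beta * p * (nu pb / 2 * r ^+ 2) <= beta * p * V u w.
  apply: ler_wpM2l; first by rewrite mulr_ge0 ?ltW.
  by rewrite /r nrmB; exact: prox_lower.
have h5 : - dotp de (w - u) <= dual de * r.
  by rewrite -dotpNr opprB /r nrmB dual_pair.
have E : dotp q v - dotp q w = dotp de (v - u) - dotp de (w - u)
    + dotp (subh pb u) (v - u) - dotp (subh pb u) (w - u).
  have Eq b : dotp q b = dotp de b + dotp (subh pb u) b by rewrite -dotpDl subrK.
  by rewrite !Eq !dotpDr !dotpNr; ring.
(* AM-GM: [A r <= c r^2 / 2 + A^2 / (2 c)] *)
have h6 : (Mh pb + dual de) * r <= beta * p * (nu pb / 2 * r ^+ 2)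
    + (Mh pb + dual de) ^+ 2 / (2 * nu pb * beta * p).
  set A := Mh pb + dual de; set c := nu pb * beta * p.
  have c0 : 0 < c by rewrite !mulr_gt0.
  rewrite -subr_ge0 (_ : _ - _ = (c * r - A) ^+ 2 / (2 * c)).
    by rewrite divr_ge0 ?sqr_ge0// mulr_ge0// ltW.
  by rewrite /c; field; rewrite !gt_eqF.
rewrite /sps_obj in h1; rewrite /sps_value; rewrite -/de -/r in h2 h6 *.
nra.
Qed.

End Composite.

Section Sliding.
Context {R : realType} {n : nat} (pb : problem R n).
Context {E : Type} (H : 'rV[R]_n -> E -> 'rV[R]_n).
Hypothesis HC : composite_problem pb.
Hypothesis HP : prox_assumptions pb.
Hypothesis HS : subproblems_solvable pb H.
Hypothesis f_tangent : forall x y, feas pb x -> feas pb y -> lin_f pb y x <= ff pb x.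
Implicit Types x y v u a : 'rV[R]_n.
Local Notation X := (feas pb).
Local Notation V := (prox pb).
Local Notation N := (nrm pb).
Local Notation dual := (dual_norm (nrm pb)).

Lemma pp_gt0 t : 0 < pp t.+1 :> R.
Proof. by rewrite divr_gt0. Qed.

Lemma betak_gt0 k : 0 < betak pb k.+1.
Proof. by rewrite divr_gt0 ?mulr_gt0 ?(Lf_gt0 HC) ?(nu_gt0 HP). Qed.

Lemma thetat01 t : 0 <= (thetat t.+1 : R) <= 1.
Proof.
have t0 : 0 <= t%:R :> R by [].
have D : 0 < t.+1%:R * (t.+1%:R + 3) :> R by rewrite mulr_gt0// addr_gt0.
rewrite /thetat; apply/andP; split; first by rewrite divr_ge0 ?mulr_ge0 ?ltW.
rewrite ler_pdivrMr// mul1r -[t.+2%:R]natr1 -[t.+1%:R]natr1; nra.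
Qed.

Lemma gammak01 k : 0 <= (gammak k.+1 : R) <= 1.
Proof.
have k0 : 0 <= k%:R :> R by [].
have D : 0 < k.+1%:R + 1 :> R by rewrite addr_gt0.
rewrite /gammak; apply/andP; split; first by rewrite divr_ge0 ?ltW.
rewrite ler_pdivrMr// mul1r -[k.+1%:R]natr1; lra.
Qed.

Definition noise u (zz : E) := H u zz - subh pb u.

(** Error of step t + 1, which has weight t + 2; there 2 p = t + 1 gives the denominator. *)
Definition call_err v (beta : R) u zz (t : nat) : R :=
  t.+2%:R * (dotp (noise u zz) (v - u)
    + (Mh pb + dual (noise u zz)) ^+ 2 / (nu pb * beta * t.+1%:R)).

(* The sum 2 + ... + (t + 1) of the weights of the first t steps. *)
Definition weight (t : nat) : R := t%:R * (t%:R + 3) / 2.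

Lemma weight_gt0 t : 0 < weight t.+1.
Proof. by rewrite divr_gt0// mulr_gt0// addr_gt0. Qed.

Section SPS.
Context (a x : 'rV[R]_n) (beta : R) (z : nat -> E).
Hypothesis Xa : X a.
Hypothesis Xx : X x.
Hypothesis beta0 : 0 < beta.
Let s := sps pb H pp thetat (lin_f pb a) x beta z.

(** [argmin] has default value 0; solvability at the feasible center u_t makes it a true
    minimizer. *)
Lemma sps_succ t : X (s t).1 ->
  is_argmin X (sps_obj pb (lin_f pb a) x beta (pp t.+1) (s t).1 (H (s t).1 (z t))) (s t.+1).1
  /\ (s t.+1).2 = (1 - thetat t.+1) *: (s t).2 + thetat t.+1 *: (s t.+1).1.
Proof.
move=> Xu; set F := sps_obj _ _ _ _ _ _ _.
have -> : s t.+1 = (argmin X F, (1 - thetat t.+1) *: (s t).2 + thetat t.+1 *: argmin X F).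
  by rewrite /F {1}/s /= -/s; case: (s t).
split => //=; have [w Fw] := HS (z t) Xa Xx Xu beta0 (pp_gt0 t).
exact: (xgetPex _ (ex_intro _ w Fw)).
Qed.

Lemma sps_feas t : X (s t).1 /\ X (s t).2.
Proof.
elim: t => [//|t [X1 X2]]; have [[X3 _] ->] := sps_succ X1; split => //.
exact/(feas_conv HC)/thetat01.
Qed.

(* With step t weighted by t + 1, the prox terms telescope. *)
Lemma sps_bound v t : X v ->
  weight t * sps_value pb a x beta (s t).2
    + beta * (weight t + 1) * V (s t).1 v
  <= weight t * sps_value pb a x beta v + beta * V x v
     + \sum_(i < t) call_err v beta (s i).1 (z i) i.
Proof.
move=> Xv; elim: t => [|t IH].
  by rewrite big_ord0 /weight !mul0r /=; lra.
have [X1 X2] := sps_feas t.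
have [am E2] := sps_succ X1.
have [X3 X4] := sps_feas t.+1.
have -> : \sum_(i < t.+1) call_err v beta (s i).1 (z i) i =
    \sum_(i < t) call_err v beta (s i).1 (z i) i + call_err v beta (s t).1 (z t) t.
  by rewrite big_ord_recr.
set SE := \sum_(i < t) _ in IH *; rewrite E2.
have h1 := sps_step HC HP Xx X1 beta0 (pp_gt0 t) am Xv.
have h2 := sps_value_conv HC HP a x beta0 X2 X3 (thetat01 t).
have nu0 := nu_gt0 HP.
rewrite /call_err /noise; set de := H _ _ - _ in h1 *.
have t0 : 0 <= t%:R :> R by [].
set w := (s t.+1).1 in h1 h2 *.
set D := (Mh pb + dual de) ^+ 2 in h1 *.
(* The choice p_t = t / 2 is made for the identities (t + 2) (1 + p_(t+1)) = [weight t.+1 + 1] and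
   (t + 2) p_(t+1) = [weight t + 1]. *)
have {}h1 : t.+2%:R * sps_value pb a x beta w + beta * (weight t.+1 + 1) * V w v <=
   t.+2%:R * sps_value pb a x beta v + beta * (weight t + 1) * V (s t).1 v
   + t.+2%:R * (dotp de (v - (s t).1) + D / (nu pb * beta * t.+1%:R)).
  have := ler_wpM2l (ler0n R t.+2) h1.
  rewrite (_ : 2 * nu pb * beta * pp t.+1 = nu pb * beta * t.+1%:R); last first.
    by rewrite /pp; field.
  set Q := D / _; set d := dotp de _; rewrite /pp /weight -[t.+2%:R]natr1 -[t.+1%:R]natr1; lra.
(* theta_t is the share of step t in the total weight, so the averaged point carries the weights of
   the telescoping sum. *)
have e1 : weight t.+1 * (1 - thetat t.+1) = weight t.
  by rewrite /weight /thetat -[t.+2%:R]natr1 -[t.+1%:R]natr1; field; rewrite !gt_eqF//; lra.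
have e2 : weight t.+1 * thetat t.+1 = t.+2%:R.
  by rewrite /weight /thetat -[t.+2%:R]natr1 -[t.+1%:R]natr1; field; rewrite !gt_eqF//; lra.
have := ler_wpM2l (ltW (weight_gt0 t)) h2.
set A0 := sps_value _ _ _ _ (s t).2; set B0 := sps_value _ _ _ _ w.
rewrite [X in _ <= X](_ : _ = weight t * A0 + t.+2%:R * B0); last first.
  by rewrite -e1 -e2; ring.
move=> h3.
have e3 : weight t.+1 = weight t + t.+2%:R by rewrite -e1 -e2; ring.
have e4 : weight t.+1 * sps_value pb a x beta v =
  weight t * sps_value pb a x beta v + t.+2%:R * sps_value pb a x beta v.
  by rewrite e3 mulrDl.
rewrite {}/A0 {}/B0 in h3; rewrite e4.
move: IH h1 h3; clear; move: (D / _) (dotp de _) (weight t) (weight _) t.+2%:R => *.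
lra.
Qed.

End SPS.

Section SGS.
Context (T : nat -> nat) (x0 : 'rV[R]_n) (z : nat -> nat -> E).
Hypothesis Xx0 : X x0.
Hypothesis T_gt0 : forall k, (0 < T k.+1)%N.
Hypothesis T_homo : forall k, (T k.+1 <= T k.+2)%N.

Let g := sgs pb H pp thetat (betak pb) gammak T x0 z.
Let y k := sgs_under gammak k.+1 (g k).

Definition inner_point (k t : nat) : 'rV[R]_n :=
  (sps pb H pp thetat (lin_f pb (y k)) (g k).1 (betak pb k.+1) (z k.+1) t).1.

(** Error of iteration k + 1 after scaling by (k + 1) (k + 2) / 2: this factor times gamma_(k+1) is
    k + 1, and the inner bound has been divided by [weight (T k.+1)]. *)
Definition iter_err v (k : nat) : R :=
  k.+1%:R / weight (T k.+1)
  * \sum_(i < T k.+1) call_err v (betak pb k.+1) (inner_point k i) (z k.+1 i) i.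

Lemma sgs_succ k :
  let s := sps pb H pp thetat (lin_f pb (y k)) (g k).1 (betak pb k.+1) (z k.+1) (T k.+1) in
  (g k.+1).1 = s.1 /\ (g k.+1).2 = (1 - gammak k.+1) *: (g k).2 + gammak k.+1 *: s.2.
Proof.
move=> s; suff -> : g k.+1 = (s.1, (1 - gammak k.+1) *: (g k).2 + gammak k.+1 *: s.2) by [].
by rewrite {1}/g /= -/g -/(y k) -/s; case: s.
Qed.

Lemma sgs_feas k : X (g k).1 /\ X (g k).2.
Proof.
elim: k => [//|k [X1 X2]].
have Xy : X (y k) by exact/(feas_conv HC)/gammak01.
have [X3 X4] := sps_feas (z k.+1) Xy X1 (betak_gt0 k) (T k.+1).
have [-> ->] := sgs_succ k; split => //; exact/(feas_conv HC)/gammak01.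
Qed.

Lemma sgs_under_feas k : X (y k).
Proof. by have [? ?] := sgs_feas k; exact/(feas_conv HC)/gammak01. Qed.

Lemma inner_point_feas k t : X (inner_point k t).
Proof.
have [X1 _] := sgs_feas k.
by have [] := sps_feas (z k.+1) (sgs_under_feas k) X1 (betak_gt0 k) t.
Qed.

(** Coefficient of the prox term in units of 2 L / nu. One inner step already has weight 2, so 3 / 2
    dominates all later values; it is the source of the constant 3 L / nu. *)
Let coef k : R := if k is k'.+1 then 1 + (weight (T k'.+1))^-1 else 3 / 2.

Lemma weight_ge2 k : 2 <= weight (T k.+1).
Proof.
have : 1 <= (T k.+1)%:R :> R by rewrite ler1n.
rewrite /weight; nra.
Qed.

Lemma coef_ninc k : coef k.+1 <= coef k.
Proof.
have w2 := weight_ge2.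
case: k => [|k] /=.
  have : (weight (T 1))^-1 <= 2^-1 by rewrite lef_pV2// posrE// (lt_le_trans _ (w2 0)).
  lra.
rewrite lerD2l lef_pV2 ?posrE ?(lt_le_trans _ (w2 _))//.
have a1 : (T k.+1)%:R <= (T k.+2)%:R :> R by rewrite ler_nat.
have a0 : 0 <= (T k.+1)%:R :> R by [].
rewrite /weight; nra.
Qed.

(** The accelerated step: f is bounded above at the new average by smoothness at the underlined
    point, and its curvature term is paid by the prox term inside [sps_value]. Scaling by (k + 1) (k
    + 2) / 2 turns 1 - gamma into the previous scale. *)
Lemma sgs_step v k : X v ->
  k.+1%:R * k.+2%:R / 2 * (Psi pb (g k.+1).2 - Psi pb v)
    + 2 * Lf pb / nu pb * coef k.+1 * V (g k.+1).1 v
  <= k%:R * k.+1%:R / 2 * (Psi pb (g k).2 - Psi pb v)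
    + 2 * Lf pb / nu pb * coef k.+1 * V (g k).1 v + iter_err v k.
Proof.
move=> Xv.
have [X1 X2] := sgs_feas k.
have Xy := sgs_under_feas k.
have [X3 X4] := sps_feas (z k.+1) Xy X1 (betak_gt0 k) (T k.+1).
have h := sps_bound (z k.+1) Xy X1 (betak_gt0 k) (T k.+1) Xv.
have [X5 X6] := sgs_feas k.+1.
have [e1 e2] := sgs_succ k.
have nu0 := nu_gt0 HP; have L0 := Lf_gt0 HC.
rewrite /iter_err -/(inner_point k).
set S := \sum_(i < _) _; rewrite -/S in h.
set s := sps _ _ _ _ _ _ _ _ _ in X3 X4 h e1 e2.
rewrite -e1 in X3 h.
have w0 : 0 < weight (T k.+1) by apply: lt_le_trans (weight_ge2 k).
rewrite /coef; set W := weight _ in h w0 *.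
set b := betak pb k.+1 in h.
have b0 : 0 < b by exact: betak_gt0.
have {}h : sps_value pb (y k) (g k).1 b s.2 + b * (1 + W^-1) * V (g k.+1).1 v
    <= sps_value pb (y k) (g k).1 b v + b * W^-1 * V (g k).1 v + W^-1 * S.
  have Wi : 0 <= W^-1 by rewrite invr_ge0 ltW.
  have := ler_wpM2l Wi h.
  rewrite [X in X <= _ -> _](_ : _ = sps_value pb (y k) (g k).1 b s.2
    + b * (1 + W^-1) * V (g k.+1).1 v); last by field; rewrite gt_eqF.
  by rewrite [X in _ <= X -> _](_ : _ = sps_value pb (y k) (g k).1 b v
    + b * W^-1 * V (g k).1 v + W^-1 * S); last by field; rewrite gt_eqF.
set ga := gammak k.+1 in e2.
have ga01 : 0 <= ga <= 1 by exact: gammak01.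
have k0 : 0 <= k%:R :> R by [].
have gaE : ga = 2 / (k%:R + 2) by rewrite /ga /gammak -[k.+1%:R]natr1; congr (_ / _); ring.
have bE : b = 2 * Lf pb / (nu pb * (k%:R + 1)) by rewrite /b /betak -[k.+1%:R]natr1.
have D : (g k.+1).2 - y k = ga *: (s.2 - (g k).1).
  by rewrite e2; apply/rowP => i; rewrite !mxE -/ga; ring.
have h1 := ff_smooth HC X6 Xy.
have h2 := hh_conv HC X2 X4 ga01.
have h3 := chi_conv HC X2 X4 ga01.
have h4 := prox_lower HC HP X1 X4.
have h5 := f_tangent X2 Xy.
have h6 := f_tangent Xv Xy.
rewrite -[ff pb (y k) + _]/(lin_f pb (y k) (g k.+1).2) D (nrmZ HC) in h1.
rewrite ger0_norm in h1; last by case/andP: ga01.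
rewrite [lin_f _ _ _](_ : _ = lin_f pb (y k) ((1 - ga) *: (g k).2 + ga *: s.2)) in h1; last first.
  by rewrite e2.
rewrite (lin_f_conv pb) in h1.
rewrite -e2 in h2 h3.
have [ga0 ga1] : 0 <= ga /\ ga <= 1 by case/andP: ga01.
(* The relation between gamma and beta that lets ga b V(x, s.2) cover L (ga r)^2 / 2. *)
have key : Lf pb * ga <= b * nu pb.
  rewrite gaE bE (_ : 2 * Lf pb / _ * nu pb = 2 * Lf pb / (k%:R + 1)); last first.
    by field; rewrite !gt_eqF//; lra.
  rewrite mulrCA mulrA ler_pM2l ?mulr_gt0// lef_pV2 ?posrE; lra.
set r := N (s.2 - _) in h1; rewrite nrmB// -/r in h4.
have {}key : Lf pb / 2 * (ga * r) ^+ 2 <= ga * (b * V (g k).1 s.2).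
  have h7 : b * (nu pb / 2 * r ^+ 2) <= b * V (g k).1 s.2 by rewrite ler_pM2l.
  have h8 : Lf pb * ga * r ^+ 2 <= b * nu pb * r ^+ 2 by rewrite ler_wpM2r ?sqr_ge0.
  have := ler_wpM2l ga0 h7; have := ler_wpM2l ga0 h8; rewrite expr2 in h8 *; lra.
have h9 : (1 - ga) * lin_f pb (y k) (g k).2 <= (1 - ga) * ff pb (g k).2.
  by rewrite ler_wpM2l// subr_ge0.
have main : Psi pb (g k.+1).2 - Psi pb v + ga * (b * (1 + W^-1) * V (g k.+1).1 v)
   <= (1 - ga) * (Psi pb (g k).2 - Psi pb v)
    + ga * (b * (1 + W^-1) * V (g k).1 v + W^-1 * S).
  have := ler_wpM2l ga0 h; have := ler_wpM2l ga0 h6.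
  rewrite /sps_value /Psi; lra.
have c0 : 0 <= k.+1%:R * k.+2%:R / 2 :> R by [].
have := ler_wpM2l c0 main; set c := k.+1%:R * k.+2%:R / 2.
have e3 : c * ga = k.+1%:R.
  by rewrite /c gaE -[k.+2%:R]natr1 -[k.+1%:R]natr1; field; rewrite gt_eqF//; lra.
have e4 : k.+1%:R * b = 2 * Lf pb / nu pb.
  by rewrite bE -[k.+1%:R]natr1; field; rewrite !gt_eqF//; lra.
have e5 : c * (1 - ga) = k%:R * k.+1%:R / 2.
  by rewrite /c gaE -[k.+2%:R]natr1 -[k.+1%:R]natr1; field; rewrite gt_eqF//; lra.
rewrite -e4 -e5 -e3.
set A := Psi _ _ - Psi _ _; set B := Psi _ _ - Psi _ _.
rewrite [X in X <= _ -> _](_ : _ = c * A + c * ga * b * (1 + W^-1) * V (g k.+1).1 v); last by ring.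
by rewrite [X in _ <= X -> _](_ : _ = c * (1 - ga) * B
  + c * ga * b * (1 + W^-1) * V (g k).1 v + c * ga / W * S); last by ring.
Qed.

Lemma sgs_bound v k : X v ->
  k%:R * k.+1%:R / 2 * (Psi pb (g k).2 - Psi pb v)
  <= 3 * Lf pb / nu pb * V x0 v + \sum_(j < k) iter_err v j.
Proof.
move=> Xv.
have nu0 := nu_gt0 HP; have L0 := Lf_gt0 HC.
have c0 : 0 <= 2 * Lf pb / nu pb by rewrite divr_ge0 ?mulr_ge0 ?ltW.
suff : k%:R * k.+1%:R / 2 * (Psi pb (g k).2 - Psi pb v)
    + 2 * Lf pb / nu pb * coef k * V (g k).1 v
  <= 3 * Lf pb / nu pb * V x0 v + \sum_(j < k) iter_err v j.
  apply: le_trans; rewrite lerDl mulr_ge0//; last first.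
    by apply: (prox_ge0 HC HP) => //; have [] := sgs_feas k.
  rewrite mulr_ge0//; case: k => [|k] /=; first by lra.
  by rewrite addr_ge0// invr_ge0 (le_trans _ (weight_ge2 k)).
elim: k => [|k IH]; first by rewrite big_ord0 !mul0r /= add0r; lra.
rewrite big_ord_recr /=.
have := sgs_step k Xv.
have V0 : 0 <= V (g k).1 v by apply: (prox_ge0 HC HP) => //; have [] := sgs_feas k.
have := ler_wpM2r V0 (ler_wpM2l c0 (coef_ninc k)).
rewrite -/(coef k.+1); lra.
Qed.
End SGS.
End Sliding.

(** * Growth at the minimizer and distance bounds for the inner steps *)

Section Minimizer.
Context {R : realType} {n : nat} (pb : problem R n).
Hypothesis HC : composite_problem pb.
Hypothesis HP : prox_assumptions pb.
Hypothesis prox_upper : forall x z, feas pb x -> feas pb z ->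
  prox pb x z <= 1 / 2 * nrm pb (x - z) ^+ 2.
Context (mu : R).
Hypothesis mu0 : 0 < mu.
Hypothesis Hmu : strongly_convex pb mu.
Context (xs : 'rV[R]_n).
Hypothesis Hxs : is_argmin (feas pb) (Psi pb) xs.
Implicit Types x y v u a : 'rV[R]_n.
Local Notation X := (feas pb).
Local Notation V := (prox pb).
Local Notation N := (nrm pb).
Local Notation dual := (dual_norm (nrm pb)).

Let Xxs : X xs. Proof. by case: Hxs. Qed.

Lemma strongly_convex_tangent x y : X x -> X y -> lin_f pb y x <= ff pb x.
Proof.
move=> Xx Xy; apply: le_trans (Hmu Xx Xy); rewrite lerDl.
by rewrite mulr_ge0 ?sqr_ge0// divr_ge0// ltW.
Qed.

(** Optimality with f linearized and the nonsmooth part h + chi kept whole; it cancels the linear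
    term of strong convexity in [quadratic_growth]. *)
Lemma minimizer_first_order v : X v ->
  hh pb xs + chi pb xs <= hh pb v + chi pb v + dotp (gradf pb xs) (v - xs).
Proof.
move=> Xv; rewrite -[dotp _ _]mul1r.
apply: (argmin_first_order (phi := fun w => hh pb w + chi pb w)
  (feas_convex HC) _ (gradfP HC) ler01 _ Xv) => [t x y Xx Xy t01|].
  have := hh_conv HC Xx Xy t01; have := chi_conv HC Xx Xy t01; lra.
split=> // w Xw; have [_ /(_ _ Xw)] := Hxs; rewrite /Psi; lra.
Qed.

Lemma quadratic_growth v : X v ->
  mu / 2 * N (v - xs) ^+ 2 <= Psi pb v - Psi pb xs.
Proof.
move=> Xv; have := Hmu Xv Xxs; have := minimizer_first_order Xv.
rewrite /Psi; lra.
Qed.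

(** Replaces a Lipschitz bound on the gradient. Compare f at w = xs + la (u - xs) with the
    smoothness bound from y, and use the tangents at y and at xs. The left side is of order la but
    the quadratic in u of order la^2, so a small la makes the latter negligible. *)
Lemma gradient_gap (la : R) y u : X y -> X u -> 0 <= la <= 1 ->
  la * dotp (gradf pb xs - gradf pb y) (u - xs)
  <= Lf pb / 2 * (la * N (u - xs) + N (y - xs)) ^+ 2.
Proof.
move=> Xy Xu la01; have Xw := feas_conv HC Xxs Xu la01.
rewrite segmentE in Xw; set w := xs + _ in Xw.
have h1 := ff_smooth HC Xw Xy.
have h2 := strongly_convex_tangent Xxs Xy.
have h3 := strongly_convex_tangent Xw Xxs.
have E b : dotp b (w - y) = la * dotp b (u - xs) + dotp b (xs - y).
  by rewrite -dotpZr -dotpDr; congr dotp; apply/rowP => i; rewrite !mxE; ring.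
have E2 b : dotp b (w - xs) = la * dotp b (u - xs).
  by rewrite -dotpZr; congr dotp; apply/rowP => i; rewrite !mxE; ring.
have h4 : N (w - y) <= la * N (u - xs) + N (y - xs).
  rewrite (nrmB HC y); apply: le_trans (nrm_triangle HC xs _ _) _.
  rewrite lerD2r (_ : w - xs = la *: (u - xs)); last by rewrite /w addrC addKr.
  by rewrite (nrmZ HC) ger0_norm//; case/andP: la01.
have h5 : Lf pb / 2 * N (w - y) ^+ 2 <= Lf pb / 2 * (la * N (u - xs) + N (y - xs)) ^+ 2.
  apply: ler_wpM2l; first by rewrite divr_ge0// ltW// (Lf_gt0 HC).
  by rewrite lerXn2r// ?nnegrE ?(nrm_ge0 HC)// (le_trans _ h4)// (nrm_ge0 HC).
rewrite /lin_f E2 in h3; rewrite /lin_f in h2; rewrite E in h1.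
rewrite dotpDl dotpNl; lra.
Qed.

(* Propagates square integrability along the search points, without which the
   mean of the noise term would be meaningless: in [gradient_gap] take
   [la = 1 / (4 (k + 1))], so that [L la = beta nu / 8] is absorbed by the prox term. *)
Lemma sps_step_dist (k : nat) (p : R) : 0 < p -> exists2 C : R, 0 <= C &
  forall a x u q w, X a -> X x -> X u ->
    is_argmin X (sps_obj pb (lin_f pb a) x (betak pb k.+1) p u q) w ->
    N (w - xs) ^+ 2 <= C * (N (a - xs) ^+ 2 + N (x - xs) ^+ 2 + N (u - xs) ^+ 2
                            + dual (q - subh pb u) ^+ 2 + 1).
Proof.
move=> p0.
have nu0 := nu_gt0 HP; have L0 := Lf_gt0 HC; have M0 := Mh_gt0 HC.
have b0 := betak_gt0 HC HP k; set b := betak pb k.+1 in b0 *.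
have bE : b = betak pb k.+1 by [].
clearbody b.
pose la : R := (4 * k.+1%:R)^-1.
have laE : la = (4 * k.+1%:R)^-1 by [].
have la0 : 0 < la by rewrite invr_gt0 mulr_gt0.
have la01 : 0 <= la <= 1.
  rewrite ltW// invf_cp1 ?mulr_gt0//.
  have : 1 <= k.+1%:R :> R by rewrite ler1n.
  lra.
pose Q := (nu pb * b * p)^-1.
have Q0 : 0 < Q by rewrite invr_gt0 mulr_gt0// mulr_gt0.
pose K := Lf pb / la + b + b * p + 1 + Q * (Mh pb ^+ 2 + 1).
have K0 : 0 <= K.
  have h : 0 <= Mh pb ^+ 2 + 1 by rewrite addr_ge0 ?sqr_ge0.
  have h1 : 0 <= Lf pb / la by rewrite divr_ge0 ?ltW.
  have h2 : 0 <= b * p := mulr_ge0 (ltW b0) (ltW p0).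
  have h3 : 0 <= Q * (Mh pb ^+ 2 + 1) := mulr_ge0 (ltW Q0) h.
  by rewrite /K; lra.
exists (K / (3 / 8 * b * nu pb)); first by rewrite divr_ge0// !mulr_ge0// ltW.
move=> a x u q w Xa Xx Xu am.
have Xw : X w by case: am.
have h1 := sps_step HC HP Xx Xu b0 p0 am Xxs.
have h2 := gradient_gap Xa Xw la01.
have h3 := minimizer_first_order Xw.
have h4 := prox_upper Xx Xxs.
have h5 := prox_upper Xu Xxs.
have h6 := prox_lower HC HP Xw Xxs.
have h7 := prox_ge0 HC HP Xx Xw.
have h8 := prox_ge0 HC HP Xw Xxs.
set de := q - subh pb u in h1 *.
have h9 : dotp de (xs - u) <= dual de * N (u - xs).
  by rewrite (nrmB HC u); exact: (dual_pair HC).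
have D0 : 0 <= dual de by exact: dual_norm_ge0 (nrm_norm HC) de.
rewrite (_ : _ / (2 * nu pb * b * p) = Q / 2 * (Mh pb + dual de) ^+ 2) in h1; last first.
  by rewrite /Q; field; rewrite !gt_eqF.
have E1 : lin_f pb a xs - lin_f pb a w = - dotp (gradf pb a) (w - xs).
  by rewrite /lin_f -!dotpNr opprB !dotpDr !dotpNr; ring.
have laL : Lf pb * la = b * nu pb / 8.
  by rewrite /la bE /betak; field; rewrite !gt_eqF.
rewrite mulrAC ler_pdivlMr; last by rewrite !mulr_gt0.
rewrite dotpDl dotpNl in h2.
set r := N (w - xs) in h2 h6 *; set rho := N (a - xs) in h2 *.
set ru := N (u - xs) in h5 h9 *; set rx := N (x - xs) in h4 *.
have h2' : dotp (gradf pb xs) (w - xs) - dotp (gradf pb a) (w - xs)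
    <= b * nu pb / 8 * r ^+ 2 + Lf pb / la * rho ^+ 2.
  rewrite -(ler_pM2l la0); apply: le_trans h2 _.
  rewrite -laL [leRHS](_ : _ = Lf pb / 2 * (2 * (la * r) ^+ 2 + 2 * rho ^+ 2)); last first.
    by field; rewrite gt_eqF.
  apply: ler_wpM2l; first by rewrite divr_ge0// ltW.
  have := sqr_ge0 (la * r - rho); rewrite !expr2; lra.
have h10 : (Mh pb + dual de) ^+ 2 <= 2 * Mh pb ^+ 2 + 2 * dual de ^+ 2.
  have := sqr_ge0 (Mh pb - dual de); rewrite !expr2; lra.
have h11 : dual de * ru <= dual de ^+ 2 + ru ^+ 2.
  have := sqr_ge0 (dual de - ru); have := sqr_ge0 ru; have := sqr_ge0 (dual de).
  rewrite !expr2; lra.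
have {}h10 := ler_wpM2l (ltW Q0) h10.
have {}h4 := ler_wpM2l (ltW b0) h4.
have bp0 : 0 < b * p by rewrite mulr_gt0.
have {}h5 := ler_wpM2l (ltW bp0) h5.
have {}h6 := ler_wpM2l (ltW b0) h6.
have h12 : 0 <= b * p * V w xs by rewrite mulr_ge0// ltW.
have {}h7 : 0 <= b * V x w by rewrite mulr_ge0// ltW.
(* 3 / 8 = 1 / 2 - 1 / 8: the lower bound on b V(w, xs) less the gradient term. *)
have lower : 3 / 8 * b * nu pb * r ^+ 2 <= Lf pb / la * rho ^+ 2
    + b * rx ^+ 2 + b * p * ru ^+ 2 + ru ^+ 2 + dual de ^+ 2
    + Q * Mh pb ^+ 2 + Q * dual de ^+ 2.
  rewrite /sps_value in h1.
  have : 0 <= b * rx ^+ 2 by rewrite mulr_ge0 ?sqr_ge0 ?ltW.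
  have : 0 <= b * p * ru ^+ 2 by rewrite mulr_ge0 ?sqr_ge0 ?ltW.
  move: (dotp _ _) (dotp _ _) (dotp _ _) E1 h1 h2' h3 h9 => d1 d2 d3 E1 h1 h2' h3 h9.
  lra.
apply: le_trans (_ : 3 / 8 * b * nu pb * r ^+ 2 <= _); first by rewrite mulrC.
apply: le_trans lower _.
have a0 : 0 <= Lf pb / la by rewrite divr_ge0// ltW.
have m0 : 0 <= Q * Mh pb ^+ 2 by rewrite mulr_ge0 ?sqr_ge0 ?ltW.
have KE : K = Lf pb / la + b + b * p + 1 + Q * Mh pb ^+ 2 + Q by rewrite /K; ring.
have k1 : Lf pb / la * rho ^+ 2 <= K * rho ^+ 2 by rewrite ler_wpM2r ?sqr_ge0//; lra.
have k2 : b * rx ^+ 2 <= K * rx ^+ 2 by rewrite ler_wpM2r ?sqr_ge0//; lra.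
have k3 : (b * p + 1) * ru ^+ 2 <= K * ru ^+ 2 by rewrite ler_wpM2r ?sqr_ge0//; lra.
have k4 : (1 + Q) * dual de ^+ 2 <= K * dual de ^+ 2 by rewrite ler_wpM2r ?sqr_ge0//; lra.
move: k1 k2 k3 k4; rewrite !mulrDr mulr1; lra.
Qed.

End Minimizer.

(** * Means of nonmeasurable functions and oracle noise *)

Section MeanBound.
Context {d : measure_display} {Om : measurableType d} {R : realType}.
Variable P : probability Om R.
Implicit Types (f g : Om -> R) (c : R).

(* Measurability is not needed as in [ge0_le_integral]: both sides are suprema
   over the simple functions below. *)
Lemma ge0_le_integralT (f g : Om -> \bar R) : (forall w, 0 <= f w)%E ->
  (forall w, f w <= g w)%E -> (\int[P]_w f w <= \int[P]_w g w)%E.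
Proof.
move=> f0 fg; have g0 w : (0 <= g w)%E by exact: le_trans (fg w).
rewrite !ge0_integralTE//; apply: le_ereal_sup => _ [h hf <-]; exists h => // w.
exact: le_trans (hf w) _.
Qed.

(* The objective values along the iterates need not be measurable: [f] has mean
   at most [c] in the sense that an integrable majorant does. *)
Definition mean_le f c := exists2 g : Om -> R, forall w, f w <= g w &
  P.-integrable setT (EFin \o g) /\ (\int[P]_w (g w)%:E <= c%:E)%E.

Lemma mean_le_expectation f c : (forall w, 0 <= f w) -> mean_le f c ->
  ('E_P[f] <= c%:E)%E.
Proof.
move=> f0 [g fg [ig gc]]; rewrite unlock; apply: le_trans gc.
by apply: ge0_le_integralT => w; rewrite lee_fin.
Qed.

Lemma mean_le_mono f f' c c' : (forall w, f w <= f' w) -> c' <= c ->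
  mean_le f' c' -> mean_le f c.
Proof.
move=> ff cc [g fg [ig gc]]; exists g; first by move=> w; exact: le_trans (fg w).
by split => //; apply: le_trans gc _; rewrite lee_fin.
Qed.

Lemma mean_leD f f' c c' : mean_le f c -> mean_le f' c' ->
  mean_le (fun w => f w + f' w) (c + c').
Proof.
move=> [g fg [ig gc]] [g' fg' [ig' gc']]; exists (fun w => g w + g' w).
  by move=> w; rewrite lerD.
split; first exact: integrableD ig ig'.
by rewrite integralD_EFin// EFinD leeD.
Qed.

Lemma mean_leZ (a : R) f c : 0 <= a -> mean_le f c ->
  mean_le (fun w => a * f w) (a * c).
Proof.
move=> a0 [g fg [ig gc]]; exists (fun w => a * g w).
  by move=> w; rewrite ler_wpM2l.
split; first exact: (@integrableZl _ _ _ _ _ measurableT a _ ig).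
under eq_integral do rewrite EFinM.
by rewrite integralZl// EFinM lee_wpmul2l.
Qed.

Lemma mean_le_cst (a : R) : mean_le (cst a) a.
Proof.
exists (cst a) => //; split; first exact: finite_measure_integrable_cst.
by have := expectation_cst P a; rewrite unlock => ->.
Qed.

Lemma mean_le_sum (N : nat) (f : 'I_N -> Om -> R) (c : 'I_N -> R) :
  (forall i, mean_le (f i) (c i)) ->
  mean_le (fun w => \sum_(i < N) f i w) (\sum_(i < N) c i).
Proof.
move=> H; suff : forall r : seq 'I_N,
  mean_le (fun w => \sum_(i <- r) f i w) (\sum_(i <- r) c i) by exact.
elim=> [|i r IH].
  by apply: mean_le_mono (mean_le_cst 0) => [w|]; rewrite big_nil.
by apply: mean_le_mono (mean_leD (H i) IH) => [w|]; rewrite big_cons.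
Qed.

Lemma mean_le_ge0 f c : measurable_fun setT f -> (forall w, 0 <= f w) ->
  (\int[P]_w (f w)%:E <= c%:E)%E -> mean_le f c.
Proof.
move=> mf f0 fc; exists f => //; split => //.
apply/integrableP; split; first exact/measurable_EFinP.
under eq_integral do rewrite gee0_abs ?lee_fin//.
exact: le_lt_trans fc (ltry _).
Qed.

Lemma integrable_mean_le f f' c : measurable_fun setT f ->
  (forall w, `|f w| <= f' w) -> mean_le f' c -> P.-integrable setT (EFin \o f).
Proof.
move=> mf ff' [g fg [ig _]].
apply: le_integrable ig => //; first exact/measurable_EFinP.
move=> w _ /=; rewrite lee_fin; apply: le_trans (ff' w) _.
by apply: le_trans (fg w) _; exact: ler_norm.
Qed.

Definition square_bounded f := exists c, mean_le (fun w => f w ^+ 2) c.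

Lemma square_boundedD f f' : square_bounded f -> square_bounded f' ->
  square_bounded (fun w => f w + f' w).
Proof.
move=> [c fc] [c' fc']; exists (2 * c + 2 * c').
have := mean_leD (mean_leZ (ler0n R 2) fc) (mean_leZ (ler0n R 2) fc').
apply: mean_le_mono => // w; have := sqr_ge0 (f w - f' w); rewrite !expr2; lra.
Qed.

Lemma square_bounded_mono f f' : (forall w, 0 <= f w <= f' w) ->
  square_bounded f' -> square_bounded f.
Proof.
move=> ff [c fc]; exists c; apply: mean_le_mono fc => // w.
by have /andP[f0 ff'] := ff w; rewrite lerXn2r// nnegrE (le_trans f0).
Qed.

End MeanBound.

(** * Integrals against the product law of independent variables *)

Section Independence.
Context {d d1 d2 : measure_display} {Om : measurableType d}
  {T1 : measurableType d1} {T2 : measurableType d2} {R : realType}.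
Variable P : probability Om R.
Variables (U : Om -> T1) (Z : Om -> T2).
Hypothesis mU : measurable_fun setT U.
Hypothesis mZ : measurable_fun setT Z.
Hypothesis indep : forall A B, measurable A -> measurable B ->
  P (U @^-1` A `&` Z @^-1` B) = (P (U @^-1` A) * P (Z @^-1` B))%E.

Let rU : {mfun Om >-> T1} := HB.pack U (isMeasurableFun.Build _ _ _ _ U mU).
Let rZ : {mfun Om >-> T2} := HB.pack Z (isMeasurableFun.Build _ _ _ _ Z mZ).
Let UZ w := (U w, Z w).
Let mUZ : measurable_fun setT UZ.
Proof. exact: measurable_fun_pair. Qed.
Let rUZ : {mfun Om >-> (T1 * T2)%type} :=
  HB.pack UZ (isMeasurableFun.Build _ _ _ _ UZ mUZ).

Let joint_law (C : set (T1 * T2)) : measurable C ->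
  (distribution P rU \x distribution P rZ)%E C = distribution P rUZ C.
Proof.
apply: product_measure_unique => A B mA mB.
rewrite /distribution /pushforward /=; exact: indep.
Qed.

Lemma indep_ge0_integral (F : T1 * T2 -> \bar R) : measurable_fun setT F ->
  (forall x, 0 <= F x)%E ->
  (\int[P]_w F (U w, Z w) = \int[P]_w \int[P]_w' F (U w, Z w'))%E.
Proof.
move=> mF F0.
rewrite -[LHS](ge0_integral_distribution rUZ mF F0).
rewrite (eq_measure_integral (distribution P rU \x distribution P rZ)%E); last first.
  by move=> A mA _; exact: (esym (joint_law mA)).
rewrite (fubini_tonelli1 F mF F0).
have mG := measurable_fun_fubini_tonelli_F (m2 := distribution P rZ) F mF F0.
rewrite ge0_integral_distribution//; last first.
  by move=> x; apply: integral_ge0 => y _; exact: F0.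
apply: eq_integral => w _; rewrite /= /fubini_F.
rewrite (ge0_integral_distribution rZ)//.
exact: measurableT_comp.
Qed.

Lemma indep_integral (F : T1 * T2 -> R) : measurable_fun setT F ->
  P.-integrable setT (fun w => (F (U w, Z w))%:E) ->
  (forall w, P.-integrable setT (fun w' => (F (U w, Z w'))%:E)) ->
  (\int[P]_w (F (U w, Z w))%:E = \int[P]_w \int[P]_w' (F (U w, Z w'))%:E)%E.
Proof.
move=> mF iF iF2.
have mF' : measurable_fun setT (EFin \o F) by exact/measurable_EFinP.
pose mm : {measure set (T1 * T2) -> \bar R} := (distribution P rU \x distribution P rZ)%E.
have iD : mm.-integrable setT (EFin \o F).
  apply/integrableP; split => //.
  rewrite (eq_measure_integral (distribution P rUZ)); last first.
    by move=> A mA _; exact: (joint_law mA).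
  rewrite ge0_integral_distribution//; last exact: measurableT_comp.
  by have /integrableP[] := iF.
rewrite -[LHS](integral_distribution (X := rUZ) mF' iF).
rewrite (eq_measure_integral mm); last first.
  by move=> A mA _; exact: (esym (joint_law mA)).
rewrite -(integral12_prod_meas1 iD).
have iG := integrable_fubini_F iD.
have E w : fubini_F (distribution P rZ) (EFin \o F) (U w)
    = (\int[P]_w' (F (U w, Z w'))%:E)%E.
  rewrite /fubini_F (integral_distribution (X := rZ) (P := P)) //.
    exact: measurableT_comp.
  exact: iF2.
have mG := measurable_fubini_F iD.
rewrite integral_distribution//; first by apply: eq_integral => w _; exact: E.
apply/integrableP; split; first exact: measurableT_comp.
have /integrableP[_] := iG.
by rewrite ge0_integral_distribution//; exact: measurableT_comp.
Qed.

End Independence.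

(** * Mean and variance of the noise of one oracle call *)

Section FreshNoise.
Context {R : realType} {n : nat} (pb : problem R n).
Context {dE : measure_display} {E : measurableType dE}.
Context {d : measure_display} {Om : measurableType d} (P : probability Om R).
Variables (H : 'rV[R]_n -> E -> 'rV[R]_n) (sigma : R).
Variables (U : Om -> 'rV[R]_n) (Z : Om -> E).
Local Notation X := (feas pb).
Local Notation N := (nrm pb).
Local Notation dual := (dual_norm (nrm pb)).
Hypothesis HC : composite_problem pb.
Hypothesis mH : measurable_fun ((X : set (borel_rV R n)) `*` [set: E])
  (fun uz : borel_rV R n * E => H uz.1 uz.2 : borel_rV R n).
Hypothesis mU : measurable_fun setT (U : Om -> borel_rV R n).
Hypothesis mZ : measurable_fun setT Z.
Hypothesis XU : forall w, X (U w).
Hypothesis indep : forall (A : set (borel_rV R n)) B, measurable A -> measurable B ->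
  P (U @^-1` A `&` Z @^-1` B) = (P (U @^-1` A) * P (Z @^-1` B))%E.
Hypothesis unbiased : forall u, X u -> forall i,
  ('E_P[fun w => H u (Z w) 0%R i] = (subh pb u 0%R i)%:E)%E.
Hypothesis variance : forall u, X u ->
  ('E_P[fun w => (dual (H u (Z w) - subh pb u) ^+ 2)%R] <= (sigma ^+ 2)%:E)%E.

Let mX : measurable (X : set (borel_rV R n)).
Proof. by apply: measurable_closed_rV; exact: feas_closed HC. Qed.

Let mXT : measurable ((X : set (borel_rV R n)) `*` [set: E]).
Proof. exact: measurableX. Qed.

(** Coordinates of the oracle extended by 0, since its measurability is assumed only over X. *)
Let Hc i : borel_rV R n * E -> R :=
  (fun uz => H uz.1 uz.2 0 i) \_ ((X : set (borel_rV R n)) `*` [set: E]).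

Let mHc i : measurable_fun setT (Hc i).
Proof.
exact: ((measurable_restrictT _ mXT).1 (measurableT_comp (measurable_coord_rV i) mH)).
Qed.

Let HcE i u z : X u -> Hc i (u, z) = H u z 0 i.
Proof. by move=> Xu; rewrite /Hc patchE mem_set. Qed.

(* [h'] is an integral of the measurable oracle over the sample, whence its
   measurability on [X] *)
Let hc i : borel_rV R n -> R := (fun u => subh pb u 0 i) \_ X.

Let rZ : {mfun Om >-> E} := HB.pack Z (isMeasurableFun.Build _ _ _ _ Z mZ).

Let mhc i : measurable_fun setT (hc i).
Proof.
apply: (measurable_restrictT _ mX).1.
(* Tonelli is applied to the positive and negative parts separately, and on X the difference of the
   two partial integrals is the expectation of the oracle. *)
pose Fp := fun uz => ((EFin \o Hc i)^\+ uz)%E.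
pose Fn := fun uz => ((EFin \o Hc i)^\- uz)%E.
have mHE : measurable_fun setT (EFin \o Hc i) by exact/measurable_EFinP.
have mFp : measurable_fun setT Fp by exact: measurable_funepos.
have mFn : measurable_fun setT Fn by exact: measurable_funeneg.
have mp := measurable_fun_fubini_tonelli_F (m2 := distribution P rZ) Fp mFp
  (fun x => funepos_ge0 _ x).
have mn := measurable_fun_fubini_tonelli_F (m2 := distribution P rZ) Fn mFn
  (fun x => funeneg_ge0 _ x).
have mD := emeasurable_funB mp mn.
have mf : measurable_fun setT (fine \o (fubini_F (distribution P rZ) Fp
    \- fubini_F (distribution P rZ) Fn)%E).
  exact: (measurableT_comp (fine_measurable measurableT) mD).
apply: eq_measurable_fun (measurable_funTS mf) => u /set_mem Xu /=.
have mpair : measurable_fun setT (fun y : E => (u : borel_rV R n, y)).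
  exact: measurable_fun_pair.
have Ep : fubini_F (distribution P rZ) Fp u
    = (\int[P]_w (EFin \o (fun w => H u (Z w) 0%R i))^\+ w)%E.
  rewrite /fubini_F (ge0_integral_distribution rZ (f := fun y => Fp (u, y))); last 2 first.
    exact: (measurableT_comp mFp mpair).
    by move=> y; exact: funepos_ge0.
  by apply: eq_integral => w _; rewrite /= /Fp !funeposE /= HcE.
have En : fubini_F (distribution P rZ) Fn u
    = (\int[P]_w (EFin \o (fun w => H u (Z w) 0%R i))^\- w)%E.
  rewrite /fubini_F (ge0_integral_distribution rZ (f := fun y => Fn (u, y))); last 2 first.
    exact: (measurableT_comp mFn mpair).
    by move=> y; exact: funeneg_ge0.
  by apply: eq_integral => w _; rewrite /= /Fn !funenegE /= HcE.
by rewrite Ep En; have := unbiased Xu i; rewrite unlock integralE => ->.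
Qed.

Let de (uz : borel_rV R n * E) : 'rV[R]_n := \row_i (Hc i uz - hc i uz.1).

Let deE u z : X u -> de (u, z) = H u z - subh pb u.
Proof.
by move=> Xu; apply/rowP => i; rewrite !mxE HcE// /hc patchE mem_set.
Qed.

Let mde : measurable_fun setT (de : borel_rV R n * E -> borel_rV R n).
Proof.
apply: measurable_rV => i; under eq_fun do rewrite mxE.
apply: measurable_funB; first exact: mHc.
by apply: measurableT_comp (mhc i) _; exact: measurable_fst.
Qed.

Let mdual : measurable_fun setT (fun uz => dual (de uz) ^+ 2).
Proof.
apply: measurable_funX; apply: measurableT_comp mde.
by apply: continuous_measurable_rV; exact/dual_norm_continuous/(nrm_norm HC).
Qed.

Lemma noise_variance :
  mean_le P (fun w => dual (noise pb H (U w) (Z w)) ^+ 2) (sigma ^+ 2).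
Proof.
rewrite /noise; under [X in mean_le _ X]eq_fun do rewrite -deE//.
have mUZ : measurable_fun setT (fun w => (U w : borel_rV R n, Z w)).
  exact: measurable_fun_pair.
apply: mean_le_ge0 => [|w|]; [exact: measurableT_comp mdual mUZ|exact: sqr_ge0|].
rewrite (indep_ge0_integral (P := P) mU mZ indep
  (F := fun uz => (dual (de uz) ^+ 2)%:E)); last first.
- by move=> uz; rewrite lee_fin sqr_ge0.
- exact/measurable_EFinP.
apply: (@le_trans _ _ (\int[P]_w (cst (sigma ^+ 2) w)%:E)%E); last first.
  by have := expectation_cst P (sigma ^+ 2); rewrite unlock => ->.
apply: ge0_le_integralT => w.
  by apply: integral_ge0 => w' _; rewrite lee_fin sqr_ge0.
have := variance (XU w); rewrite unlock; apply: le_trans.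
by apply: ge0_le_integralT => w'; rewrite lee_fin ?sqr_ge0// deE.
Qed.

(** The second moment of the search point enters through the bound of the pairing by the sum of the
    squares of its two norms. This gives the integrability that Fubini asks for; with the search
    point frozen, each noise coordinate has mean zero. *)
Lemma noise_unbiased xs (c : R) :
  mean_le P (fun w => N (U w - xs) ^+ 2) c ->
  mean_le P (fun w => dotp (noise pb H (U w) (Z w)) (xs - U w)) 0.
Proof.
move=> Uc.
have mUZ : measurable_fun setT (fun w => (U w : borel_rV R n, Z w)).
  exact: measurable_fun_pair.
pose F (uz : borel_rV R n * E) := dotp (de uz) (xs - (uz.1 : 'rV[R]_n)).
have mF : measurable_fun setT F.
  apply: measurable_sum => i; apply: measurable_funM.
    exact: measurableT_comp (measurable_coord_rV i) mde.
  under eq_fun do rewrite !mxE.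
  apply: measurable_funB => //.
  exact: measurableT_comp (measurable_coord_rV i) measurable_fst.
have bF u z : X u -> `|F (u, z)| <= dual (H u z - subh pb u) ^+ 2 + N (u - xs) ^+ 2.
  move=> Xu; rewrite /F deE//=; set q := _ - subh pb u.
  have h1 : dotp q (xs - u) <= dual q * N (u - xs).
    by rewrite (nrmB HC u); exact: dual_pair.
  have h2 : - dotp q (xs - u) <= dual q * N (u - xs).
    by rewrite -dotpNr opprB; exact: dual_pair.
  have : `|dotp q (xs - u)| <= dual q * N (u - xs) by rewrite ler_norml; lra.
  have := sqr_ge0 (dual q - N (u - xs)); have := sqr_ge0 (dual q).
  have := sqr_ge0 (N (u - xs)); rewrite !expr2; lra.
have iF : P.-integrable setT (fun w => (F (U w, Z w))%:E).
  apply: (integrable_mean_le (f' := fun w => dual (noise pb H (U w) (Z w)) ^+ 2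
    + N (U w - xs) ^+ 2) _ _ (mean_leD noise_variance Uc)) => //.
    exact: measurableT_comp mF mUZ.
  by move=> w; exact: bF.
have vu u : X u -> mean_le P (fun w => dual (H u (Z w) - subh pb u) ^+ 2) (sigma ^+ 2).
  move=> Xu; apply: mean_le_ge0 => [|w|].
  - under eq_fun do rewrite -deE//.
    exact: measurableT_comp mdual (measurable_fun_pair _ mZ).
  - exact: sqr_ge0.
  - by have := variance Xu; rewrite unlock.
have iF2 u : X u -> P.-integrable setT (fun w => (F (u, Z w))%:E).
  move=> Xu; apply: (integrable_mean_le (f' := fun w => dual (H u (Z w) - subh pb u) ^+ 2
    + N (u - xs) ^+ 2) _ _ (mean_leD (vu u Xu) (mean_le_cst P (N (u - xs) ^+ 2)))) => //.
    exact: measurableT_comp mF (measurable_fun_pair _ mZ).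
  by move=> w; exact: bF.
exists (fun w => F (U w, Z w)); first by move=> w; rewrite /F deE.
split => //.
rewrite (indep_integral mU mZ indep mF iF (fun w => iF2 _ (XU w))).
rewrite integral0_eq// => w _; move: (U w) (XU w) => u Xu.
pose q i w' : R := H u (Z w') 0 i - subh pb u 0 i.
have mHu i : measurable_fun setT (fun w' => H u (Z w') 0 i).
  under eq_fun do rewrite -(HcE i _ Xu).
  exact: measurableT_comp (mHc i) (measurable_fun_pair _ mZ).
(* Integrability of a noise coordinate comes from the variance bound, pairing with a basis
   vector. *)
have iq i : P.-integrable setT (EFin \o q i).
  pose e_i : 'rV[R]_n := delta_mx 0 i.
  have qE w' : q i w' = dotp (H u (Z w') - subh pb u) e_i.
    rewrite /dotp (bigD1 i)//= big1 ?addr0 => [|j ji].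
      by rewrite !mxE !eqxx mulr1.
    by rewrite [e_i 0 j]mxE (negbTE ji) andbF mulr0.
  apply: (integrable_mean_le (f' := fun w => dual (H u (Z w) - subh pb u) ^+ 2
    + N e_i ^+ 2) _ _ (mean_leD (vu u Xu) (mean_le_cst P (N e_i ^+ 2)))).
    exact: measurable_funB.
  move=> w'; rewrite qE; set v := _ - subh pb u.
  have h1 := dual_normP (nrm_norm HC) v e_i.
  have h2 := dual_normP (nrm_norm HC) v (- e_i).
  rewrite dotpNr in h2.
  have h3 : N (- e_i) = N e_i by rewrite -[- e_i]sub0r (nrmB HC) subr0.
  have : `|dotp v e_i| <= dual v * N e_i by rewrite ler_norml; rewrite h3 in h2; lra.
  have := sqr_ge0 (dual v - N e_i); have := sqr_ge0 (dual v).
  have := sqr_ge0 (N e_i); rewrite !expr2; lra.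
have q0 i : (\int[P]_w' (q i w')%:E = 0)%E.
  have iH : P.-integrable setT (EFin \o (fun w' => H u (Z w') 0 i)).
    have := integrableD measurableT (iq i)
      (finite_measure_integrable_cst P (subh pb u 0 i) measurableT).
    by apply: eq_integrable => // w' _; rewrite /= /q -EFinD subrK.
  rewrite /q integralB_EFin//; last exact: finite_measure_integrable_cst.
  have := unbiased Xu i; have := expectation_cst P (subh pb u 0 i).
  by rewrite unlock => -> ->; rewrite subee.
transitivity (\int[P]_w' \sum_(i < n) ((xs - u) 0%R i)%:E * (q i w')%:E)%E.
  apply: eq_integral => w' _; rewrite /F deE//= sumEFin; congr EFin.
  by apply: eq_bigr => i _; rewrite mulrC /q !mxE.
rewrite integral_sum//; last first.
  by move=> i; exact: (integrableZl measurableT _ (iq i)).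
by rewrite big1// => i _; rewrite integralZl//; [rewrite q0 mule0|exact: iq].
Qed.

End FreshNoise.

(** * Multi-phase method *)

Section Ceiling.
Context {R : realType}.
Implicit Types x y : R.

Lemma natceilE x : 0 <= x -> (natceil x)%:R = (Num.ceil x)%:~R :> R.
Proof.
move=> x0; rewrite /natceil -[in RHS](@gez0_abs (Num.ceil x))// ceil_ge0.
by apply: lt_le_trans x0; rewrite ltrN10.
Qed.

Lemma natceil_ge x : 0 <= x -> x <= (natceil x)%:R.
Proof. by move=> x0; rewrite natceilE// ceil_ge. Qed.

Lemma natceil_lt x : 0 <= x -> (natceil x)%:R < x + 1.
Proof. by move=> x0; rewrite natceilE//; have := ceilB1_lt x; rewrite intrD; lra. Qed.

Lemma natceil_gt0 x : 0 < x -> (0 < natceil x)%N.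
Proof. by move=> x0; rewrite -(ltr0n R) (lt_le_trans x0)// natceil_ge// ltW. Qed.

Lemma natceil_homo x y : 0 <= x -> x <= y -> (natceil x <= natceil y)%N.
Proof.
move=> x0 xy; rewrite -(ler_nat R) !natceilE//; last exact: le_trans xy.
by rewrite ler_int le_ceil.
Qed.

End Ceiling.

Section MultiPhase.
Context {R : realType} {n : nat} (pb : problem R n) (mu sigma Delta0 : R).
Context (xs y0 : 'rV[R]_n) {dE : measure_display} {E : measurableType dE}.
Context (H : 'rV[R]_n -> E -> 'rV[R]_n).
Context {d : measure_display} {Om : measurableType d} (P : probability Om R).
Context (xi : nat -> nat -> nat -> Om -> E).
Let N0 := natceil (4 * Num.sqrt (2 * Lf pb / (nu pb * mu))).
Let z w s k t := xi s k t w.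
Let Y s w := msgs pb H mu sigma Delta0 N0 y0 (z w) s.
Let search (c : call) w :=
  search_point pb H mu sigma Delta0 N0 y0 (z w) c.1.1 c.1.2 c.2.
Let T := TT pb mu sigma Delta0 N0.
Hypothesis HC : composite_problem pb.
Hypothesis Hxs : is_argmin (feas pb) (Psi pb) xs.
Hypothesis HP : prox_assumptions pb.
Hypothesis HS : subproblems_solvable pb H.
Hypothesis mu0 : 0 < mu.
Hypothesis Hmu : strongly_convex pb mu.
Hypothesis prox_upper : forall x z, feas pb x -> feas pb z ->
  prox pb x z <= 1 / 2 * nrm pb (x - z) ^+ 2.
Hypothesis Xy0 : feas pb y0.
Hypothesis Delta0_gt0 : 0 < Delta0.
Hypothesis y0_gap : Psi pb y0 - Psi pb xs <= Delta0.
Hypothesis HO : stochastic_oracle pb P [set c | is_call N0 T c] H sigma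
  (fun c => xi c.1.1 c.1.2 c.2) search.
Local Notation X := (feas pb).
Local Notation V := (prox pb).
Local Notation N := (nrm pb).
Local Notation dual := (dual_norm (nrm pb)).
Let L0 := Lf_gt0 HC.
Let nu0 := nu_gt0 HP.
Let f_tangent := strongly_convex_tangent mu0 Hmu.
Let Xxs : X xs. Proof. by case: Hxs. Qed.

Let noise_scale : R := Mh pb ^+ 2 + sigma ^+ 2.

Let noise_scale_gt0 : 0 < noise_scale.
Proof. by rewrite ltr_pwDl ?sqr_ge0// exprn_gt0// (Mh_gt0 HC). Qed.

Let N0_gt0 : (0 < N0)%N.
Proof. by rewrite natceil_gt0// mulr_gt0// sqrtr_gt0 divr_gt0// mulr_gt0. Qed.

Let N0_large : 32 * (Lf pb / (nu pb * mu)) <= N0%:R ^+ 2.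
Proof.
have k0 : 0 <= 2 * Lf pb / (nu pb * mu) by rewrite divr_ge0 ?mulr_ge0// ltW.
have h : 4 * Num.sqrt (2 * Lf pb / (nu pb * mu)) <= N0%:R.
  by apply: natceil_ge; rewrite mulr_ge0// sqrtr_ge0.
apply: (@le_trans _ _ ((4 * Num.sqrt (2 * Lf pb / (nu pb * mu))) ^+ 2)).
  by rewrite exprMn sqr_sqrtr//; lra.
by apply: lerXn2r; rewrite ?nnegrE ?mulr_ge0 ?sqrtr_ge0.
Qed.

Let Dt s : R := Dtilde pb mu Delta0 s.

Let Dt_gt0 s : 0 < Dt s.
Proof. by rewrite divr_gt0// !mulr_gt0// exprn_gt0. Qed.

Let T_arg s k : R := N0%:R * noise_scale * k%:R ^+ 2 / (Dt s * Lf pb ^+ 2).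

Let T_arg_gt0 s k : 0 < T_arg s k.+1.
Proof.
apply: divr_gt0; last by apply: mulr_gt0 (Dt_gt0 s) _; rewrite exprn_gt0.
by apply: mulr_gt0; [apply: mulr_gt0; rewrite ?ltr0n|rewrite exprn_gt0].
Qed.

Let T_gt0 s k : (0 < T s k.+1)%N.
Proof. exact: natceil_gt0 (T_arg_gt0 s k). Qed.

Let T_homo s k : (T s k.+1 <= T s k.+2)%N.
Proof.
apply: natceil_homo; first exact: ltW (T_arg_gt0 s k).
apply: ler_wpM2r.
  by rewrite invr_ge0; apply: mulr_ge0 (sqr_ge0 _); exact: ltW (Dt_gt0 s).
apply: ler_wpM2l; first by apply: mulr_ge0 => //; exact: ltW noise_scale_gt0.
by apply: lerXn2r; rewrite ?nnegrE// ler_nat.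
Qed.

Let g s w := sgs pb H pp thetat (betak pb) gammak (T s.+1) (Y s w) (z w s.+1).

Lemma iterate_feas s w : X (Y s w).
Proof.
elim: s => [//|s IH].
by have [_] := sgs_feas HC HP HS (T s.+1) (z w s.+1) IH N0.
Qed.

(** Phases and iterations are counted from 0 here: this is the search point of call (s + 1, k + 1,
    t), equal to [search] by computation. *)
Let point s w k t := inner_point pb H (T s.+1) (Y s w) (z w s.+1) k t.

Let point_feas s w k t : X (point s w k t).
Proof. exact: (inner_point_feas HC HP HS (T s.+1) (z w s.+1) (iterate_feas s w) k t). Qed.

Let call_noise s k t w := noise pb H (point s w k t) (xi s.+1 k.+1 t w).

Let is_callP s k t : (k < N0)%N -> (t < T s.+1 k.+1)%N ->
  [set c | is_call N0 T c] (s.+1, k.+1, t).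
Proof. by move=> kN tT; rewrite /= kN tT. Qed.

Let call_indep s k t (A : set (borel_rV R n)) (B : set E) :
  (k < N0)%N -> (t < T s.+1 k.+1)%N -> measurable A -> measurable B ->
  P ((point s)^~ k ^~ t @^-1` A `&` xi s.+1 k.+1 t @^-1` B)
  = (P ((point s)^~ k ^~ t @^-1` A) * P (xi s.+1 k.+1 t @^-1` B))%E.
Proof.
move=> kN tT mA mB; have cc := is_callP kN tT.
apply: (sample_fresh HO cc); last by exists B => //; rewrite setTI.
(* The history of a call contains its own search point. *)
apply: sub_sigma_algebra; right; exists (s.+1, k.+1, t); first by split => //; right.
by exists A => //; rewrite setTI.
Qed.

Lemma call_noise_variance s k t : (k < N0)%N -> (t < T s.+1 k.+1)%N ->
  mean_le P (fun w => dual (call_noise s k t w) ^+ 2) (sigma ^+ 2).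
Proof.
move=> kN tT; have cc := is_callP kN tT.
apply: (noise_variance (Z := xi s.+1 k.+1 t) HC (oracle_measurable HO)
  (search_measurable HO cc) (sample_measurable HO cc) _ _ _ _).
- by move=> w; exact: point_feas.
- by move=> A B; exact: call_indep.
- by move=> u Xu i; exact: (oracle_unbiased HO cc).
- by move=> u Xu; exact: (oracle_variance HO cc).
Qed.

Lemma call_noise_unbiased s k t (c : R) : (k < N0)%N -> (t < T s.+1 k.+1)%N ->
  mean_le P (fun w => N (point s w k t - xs) ^+ 2) c ->
  mean_le P (fun w => dotp (call_noise s k t w) (xs - point s w k t)) 0.
Proof.
move=> kN tT; have cc := is_callP kN tT.
apply: (noise_unbiased (Z := xi s.+1 k.+1 t) (sigma := sigma) HC (oracle_measurable HO)
  (search_measurable HO cc) (sample_measurable HO cc) _ _ _ _).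
- by move=> w; exact: point_feas.
- by move=> A B; exact: call_indep.
- by move=> u Xu i; exact: (oracle_unbiased HO cc).
- by move=> u Xu; exact: (oracle_variance HO cc).
Qed.

Let conv_dist (t : R) a b : 0 <= t <= 1 ->
  N ((1 - t) *: a + t *: b - xs) <= N (a - xs) + N (b - xs).
Proof.
move=> /andP[t0 t1].
rewrite (_ : _ - xs = (1 - t) *: (a - xs) + t *: (b - xs)); last first.
  by apply/rowP => i; rewrite !mxE; ring.
apply: le_trans (nrmD HC _ _) _; rewrite !(nrmZ HC) !ger0_norm ?subr_ge0//.
have := nrm_ge0 HC (a - xs); have := nrm_ge0 HC (b - xs); nra.
Qed.

Let square_bounded_conv (t : R) (a b : Om -> 'rV[R]_n) : 0 <= t <= 1 ->
  square_bounded P (fun w => N (a w - xs)) ->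
  square_bounded P (fun w => N (b w - xs)) ->
  square_bounded P (fun w => N ((1 - t) *: a w + t *: b w - xs)).
Proof.
move=> t01 ba bb; apply: square_bounded_mono (square_boundedD ba bb) => w.
by rewrite (nrm_ge0 HC) conv_dist.
Qed.

Let inner s k w t := sps pb H pp thetat (lin_f pb (sgs_under gammak k.+1 (g s w k)))
  (g s w k).1 (betak pb k.+1) (z w s.+1 k.+1) t.

(** The bound may worsen with every step; only finiteness matters, as the values of the second
    moments never enter the rate. *)
Let inner_square_bounded s k t : (k < N0)%N ->
  square_bounded P (fun w => N ((g s w k).1 - xs)) ->
  square_bounded P (fun w => N ((g s w k).2 - xs)) ->
  (t <= T s.+1 k.+1)%N ->
  square_bounded P (fun w => N ((inner s k w t).1 - xs)) /\
  square_bounded P (fun w => N ((inner s k w t).2 - xs)).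
Proof.
move=> kN b1 b2; elim: t => [//|t IH] tT.
have [bu but] := IH (ltnW tT).
have [by_ Hy] := square_bounded_conv (gammak01 k) b2 b1.
have [cx Hx] := b1; have [cu Hu] := bu.
have Hn := call_noise_variance kN tT.
have [C C0 step] := sps_step_dist HC HP prox_upper mu0 Hmu Hxs k (pp_gt0 t).
have Xg w : X (g s w k).1.
  by have [] := sgs_feas HC HP HS (T s.+1) (z w s.+1) (iterate_feas s w) k.
have Xu w : X (sgs_under gammak k.+1 (g s w k)).
  exact: (sgs_under_feas HC HP HS (T s.+1) (z w s.+1) (iterate_feas s w) k).
have succ w := sps_succ HS (z := z w s.+1 k.+1) (Xu w) (Xg w) (betak_gt0 HC HP k)
  (point_feas s w k t).
have bw : square_bounded P (fun w => N ((inner s k w t.+1).1 - xs)).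
  have := mean_leZ C0 (mean_leD (mean_leD (mean_leD (mean_leD Hy Hx) Hu) Hn)
    (mean_le_cst P 1)).
  move=> HH; eexists; apply: mean_le_mono (lexx _) HH => w.
  exact: (step _ _ _ _ _ (Xu w) (Xg w) (point_feas s w k t) (succ w).1).
split => //.
have := square_bounded_conv (thetat01 t) but bw.
move=> [c Hc]; exists c; apply: mean_le_mono (lexx _) Hc => w.
by rewrite /inner (succ w).2.
Qed.

Let iterates_square_bounded s k : (k <= N0)%N ->
  square_bounded P (fun w => N (Y s w - xs)) ->
  square_bounded P (fun w => N ((g s w k).1 - xs)) /\
  square_bounded P (fun w => N ((g s w k).2 - xs)).
Proof.
move=> kN bY; elim: k kN => [//|k IH] kN.
have [b1 b2] := IH (ltnW kN).
have [b3 b4] := inner_square_bounded kN b1 b2 (leqnn _).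
have succ w := sgs_succ pb H (T s.+1) (Y s w) (z w s.+1) k.
split.
  have [c Hc] := b3; exists c; apply: mean_le_mono (lexx _) Hc => w.
  by have [-> _] := succ w.
have [c Hc] := square_bounded_conv (gammak01 k) b2 b4.
by exists c; apply: mean_le_mono (lexx _) Hc => w; have [_ ->] := succ w.
Qed.

(** Uniform in t, because the weight t + 2 meets the denominator t + 1, at the cost of a factor 2;
    the other factor 2 comes from squaring the sum of M and the noise. *)
Let call_err_mean s k t : (k < N0)%N -> (t < T s.+1 k.+1)%N ->
  square_bounded P (fun w => N (Y s w - xs)) ->
  mean_le P (fun w => call_err pb H xs (betak pb k.+1) (point s w k t)
      (z w s.+1 k.+1 t) t)
    (4 * noise_scale / (nu pb * betak pb k.+1)).
Proof.
move=> kN tT bY.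
have [b1 b2] := iterates_square_bounded (ltnW kN) bY.
have [[c Hc] _] := inner_square_bounded kN b1 b2 (ltnW tT).
have Hm := call_noise_unbiased kN tT Hc.
have Hv := call_noise_variance kN tT.
have b0 := betak_gt0 HC HP k; set b := betak pb k.+1 in b0 *; clearbody b.
have nb0 : 0 < nu pb * b by exact: mulr_gt0.
have q0 : 0 < nu pb * b * t.+1%:R by rewrite mulr_gt0.
set q := nu pb * b * t.+1%:R in q0 *.
have q2 : 0 <= 2 / q by rewrite divr_ge0// ltW.
have := mean_leZ (ler0n R t.+2)
  (mean_leD Hm (mean_leZ q2 (mean_leD (mean_le_cst P (Mh pb ^+ 2)) Hv))).
apply: mean_le_mono => [w|]; rewrite -/noise_scale.
  rewrite /call_err -/q; apply: ler_wpM2l; rewrite // lerD2l.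
  rewrite [leRHS]mulrAC; apply: ler_wpM2r; first by rewrite invr_ge0 ltW.
  set D := dual _; have := sqr_ge0 (Mh pb - D); rewrite /cst /call_noise -/D !expr2; lra.
rewrite add0r /q [leLHS](_ : _ = t.+2%:R / t.+1%:R * (2 * noise_scale / (nu pb * b))); last first.
  by field; rewrite !gt_eqF.
rewrite [leRHS](_ : _ = 2 * (2 * noise_scale / (nu pb * b))); last by field; rewrite !gt_eqF.
apply: ler_wpM2r; first by rewrite divr_ge0 ?mulr_ge0 ?ltW.
rewrite ler_pdivrMr// -[t.+2%:R]natr1; have : 1 <= t.+1%:R :> R by rewrite ler1n.
lra.
Qed.

(** With t inner steps the sum of the call errors, divided by [weight], is of order 1 / (t + 3), and
    the lower bound on T_k cancels the remaining factor k^2. *)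
Let iter_err_mean s k : (k < N0)%N ->
  square_bounded P (fun w => N (Y s w - xs)) ->
  mean_le P (fun w => iter_err pb H (T s.+1) (Y s w) (z w s.+1) xs k)
    (4 * Dt s.+1 * Lf pb / N0%:R).
Proof.
move=> kN bY.
have w0 : 0 <= k.+1%:R / weight (T s.+1 k.+1) :> R.
  rewrite divr_ge0//; have := T_gt0 s.+1 k; case: (T s.+1 k.+1) => // t _.
  exact: ltW (weight_gt0 t).
have := mean_leZ w0 (mean_le_sum (fun i : 'I_(T s.+1 k.+1) =>
  call_err_mean kN (ltn_ord i) bY)).
apply: mean_le_mono => [//|].
rewrite sumr_const card_ord -[_ *+ T _ _]mulr_natl.
have TT : T_arg s.+1 k.+1 <= (T s.+1 k.+1)%:R by apply: natceil_ge; exact: ltW (T_arg_gt0 _ _).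
have t0 : 0 < (T s.+1 k.+1)%:R :> R by rewrite ltr0n.
move: TT t0; rewrite /weight; set t := (T s.+1 k.+1)%:R => TT t0.
have N0R : 0 < N0%:R :> R by rewrite ltr0n.
have D0 := Dt_gt0 s.+1.
move: TT; rewrite /T_arg; set D := Dt s.+1 in D0 *; set k1 := k.+1%:R.
have k0 : 0 < k1 by rewrite ltr0n.
set n0 := N0%:R in N0R *.
rewrite ler_pdivrMr; last by rewrite mulr_gt0// exprn_gt0.
move=> TT.
rewrite [leLHS](_ : _ = 4 * (noise_scale * k1 ^+ 2) / ((t + 3) * Lf pb)); last first.
  by rewrite /betak -/k1; field; rewrite !gt_eqF//; lra.
rewrite ler_pdivrMr ?mulr_gt0//; last by lra.
rewrite mulrAC ler_pdivlMr//.
have : 0 <= D * Lf pb ^+ 2 by rewrite mulr_ge0 ?sqr_ge0// ltW.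
lra.
Qed.

(* Phase [s + 1] contributes [2 / (N0 (N0 + 1)) * (3 L V / nu + 4 Dt L)], where
   [V <= Delta0 / (mu 2^s)] in mean; this is
   [20 L / (nu mu N0 (N0 + 1)) * Delta0 / 2^(s+1)], and [N0^2 >= 32 L / (nu mu)]. *)
Lemma msgs_mean s :
  mean_le P (fun w => Psi pb (Y s w) - Psi pb xs) (Delta0 / 2 ^+ s).
Proof.
elim: s => [|s IH].
  by rewrite expr0 divr1; apply: mean_le_mono (mean_le_cst P Delta0).
have m2 : 0 <= 2 / mu by rewrite divr_ge0// ltW.
have HY : mean_le P (fun w => N (Y s w - xs) ^+ 2) (2 / mu * (Delta0 / 2 ^+ s)).
  apply: mean_le_mono (lexx _) (mean_leZ m2 IH) => w.
  have := quadratic_growth HC Hmu Hxs (iterate_feas s w).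
  by move=> h; rewrite [leRHS]mulrAC ler_pdivlMr//; lra.
have bY : square_bounded P (fun w => N (Y s w - xs)) by eexists; exact: HY.
have c0 : 0 <= 3 * Lf pb / nu pb * (1 / 2).
  by rewrite mulr_ge0// divr_ge0 ?mulr_ge0// ltW.
have Hsum := mean_leD (mean_leZ c0 HY)
  (mean_le_sum (fun j : 'I_N0 => iter_err_mean (ltn_ord j) bY)).
have N0R : 0 < N0%:R :> R by rewrite ltr0n.
have a0 : 0 <= 2 / (N0%:R * N0.+1%:R) :> R by rewrite divr_ge0// mulr_ge0.
apply: mean_le_mono (mean_leZ a0 Hsum) => [w|].
  have h := sgs_bound HC HP HS f_tangent (z w s.+1) (iterate_feas s w)
    (T_gt0 s.+1) (T_homo s.+1) N0 Xxs.
  have hV := prox_upper (iterate_feas s w) Xxs.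
  rewrite mulrAC ler_pdivlMr ?mulr_gt0 ?ltr0n//.
  have c1 : 0 <= 3 * Lf pb / nu pb by rewrite divr_ge0 ?mulr_ge0// ltW.
  have := ler_wpM2l c1 hV; move: h; rewrite -/(Y s.+1 w).
  rewrite -[Psi pb (sgs _ _ _ _ _ _ _ _ _ _).2]/(Psi pb (Y s.+1 w)).
  set S := \sum_(j < N0) _ => h hV'.
  have {}h := le_trans h (lerD hV' (lexx S)).
  lra.
rewrite sumr_const card_ord -[_ *+ N0]mulr_natl.
have e0 : 0 < 2 ^+ s :> R by rewrite exprn_gt0.
pose ka := Lf pb / (nu pb * mu).
rewrite [leLHS](_ : _ = 20 * ka / (N0%:R * (N0%:R + 1)) * (Delta0 / 2 ^+ s.+1)); last first.
  rewrite /Dt /Dtilde /ka exprS -[N0.+1%:R]natr1; field.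
  by rewrite !gt_eqF//; lra.
rewrite ler_piMl//; first by rewrite divr_ge0 ?ltW// exprn_gt0.
have := N0_large; rewrite -/ka => h.
have ka0 : 0 < ka by rewrite divr_gt0// mulr_gt0.
by rewrite ler_pdivrMr ?mulr_gt0//; lra.
Qed.

End MultiPhase.

(** * Counting gradient and oracle evaluations *)

Section Complexity.
Context {R : realType} {n : nat} (pb : problem R n) (mu sigma Delta0 : R).
Hypothesis L_gt0 : 0 < Lf pb.
Hypothesis nu_gt0 : 0 < nu pb.
Hypothesis mu_gt0 : 0 < mu.
Hypothesis Delta0_gt0 : 0 < Delta0.
Let ns : R := Mh pb ^+ 2 + sigma ^+ 2.
Let ns_ge0 : 0 <= ns. Proof. by rewrite addr_ge0 ?sqr_ge0. Qed.

Lemma grad_evalsE N0 S : grad_evals N0 S = (S * N0)%N.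
Proof. by rewrite /grad_evals sum_nat_const_nat subn1. Qed.

(** Bounding k by N0 costs only a constant and yields N0^4 per phase. Since Dtilde halves, the
    phases form a geometric sum, at most twice its last term; the ceilings add one call per
    iteration. *)
Lemma oracle_evals_le N0 S : (oracle_evals pb mu sigma Delta0 N0 S)%:R <=
  2 * (N0%:R ^+ 4 * ns * (nu pb * mu) / (Delta0 * Lf pb ^+ 2)) * 2 ^+ S
  + S%:R * N0%:R :> R.
Proof.
set A := _ / _.
have A0 : 0 <= A.
  rewrite /A; apply: divr_ge0; last by rewrite mulr_ge0 ?sqr_ge0// ltW.
  by rewrite !mulr_ge0 ?exprn_ge0// ltW.
have phase s : (\sum_(1 <= k < N0.+1) TT pb mu sigma Delta0 N0 s k)%:R
    <= A * 2 ^+ s + N0%:R.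
  have e0 : 0 < 2 ^+ s :> R by rewrite exprn_gt0.
  have D0 : 0 < Dtilde pb mu Delta0 s by rewrite divr_gt0 ?mulr_gt0.
  rewrite natr_sum; apply: (@le_trans _ _ (\sum_(1 <= k < N0.+1)
      (N0%:R * ns * N0%:R ^+ 2 / (Dtilde pb mu Delta0 s * Lf pb ^+ 2) + 1))).
    rewrite big_seq [leRHS]big_seq; apply: ler_sum => k.
    rewrite mem_index_iota ltnS => /andP[_ kN].
    have c0 : 0 <= (Dtilde pb mu Delta0 s * Lf pb ^+ 2)^-1.
      by rewrite invr_ge0 mulr_ge0 ?sqr_ge0// ltW.
    have b0 : 0 <= N0%:R * ns :> R by rewrite mulr_ge0.
    apply: le_trans (ltW (natceil_lt _)) _.
      by rewrite mulr_ge0// mulr_ge0// sqr_ge0.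
    rewrite lerD2r; apply: ler_wpM2r => //; apply: ler_wpM2l => //.
    by apply: lerXn2r; rewrite ?nnegrE// ler_nat.
  rewrite sumr_const_nat subn1 /= -[leLHS]mulr_natl mulrDr mulr1 lerD2r.
  rewrite le_eqVlt; apply/orP; left; apply/eqP.
  by rewrite /A /Dtilde; field; rewrite !gt_eqF.
rewrite /oracle_evals natr_sum.
apply: (@le_trans _ _ (\sum_(1 <= s < S.+1) (A * 2 ^+ s + N0%:R))).
  by apply: ler_sum => s _; exact: phase.
elim: S => [|S IH].
  by rewrite big_geq// mul0r addr0 mulr_ge0// mulr_ge0.
rewrite big_nat_recr//= exprS -[S.+1%:R]natr1.
have : 0 <= A * 2 ^+ S by rewrite mulr_ge0 ?exprn_ge0.
lra.
Qed.

(** S is the ceiling of the logarithm. The threshold Delta0 / 2 makes the logarithm at least 1, so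
    that rounding up at most doubles it. *)
Lemma phases_log2 (eps : R) : 0 < eps -> eps <= Delta0 / 2 ->
  exists S : nat, [/\ Delta0 / 2 ^+ S <= eps, 2 ^+ S <= 2 * (Delta0 / eps) &
    S%:R <= 2 * log2 (Num.max (Delta0 / eps) 1)].
Proof.
move=> e0 eD; set r := Delta0 / eps.
have r2 : 2 <= r by rewrite ler_pdivlMr//; lra.
have r0 : 0 < r by lra.
rewrite max_l; last by lra.
have ln2 : 0 < ln (2 : R) by rewrite ln_gt0// ltr1n.
have l1 : 1 <= log2 r.
  by rewrite /log2 ler_pdivlMr// mul1r ler_ln ?posrE.
have lE : log2 r * ln 2 = ln r by rewrite /log2 divfK// gt_eqF.
have l0 : 0 <= log2 r by lra.
exists (natceil (log2 r)).
have S1 := natceil_ge l0; have S2 := natceil_lt l0.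
set S := natceil _ in S1 S2 *.
have lnS : ln (2 ^+ S) = S%:R * ln 2 :> R by rewrite lnXn// mulr_natl.
have e2 : 0 < 2 ^+ S :> R by rewrite exprn_gt0.
split; last by apply: le_trans (ltW S2) _; rewrite mulr_natl mulr2n lerD2l.
- rewrite ler_pdivrMr// mulrC -ler_pdivrMr// -/r -ler_ln ?posrE// lnS -lE.
  by rewrite ler_pM2r.
- have r20 : 0 < 2 * r by rewrite mulr_gt0.
  rewrite -(ler_ln e2 r20) lnS lnM ?posrE//.
  by rewrite -lE -[X in _ <= X + _]mul1r -mulrDl ler_pM2r// addrC ltW.
Qed.

(** N0^4 is of order (L / (nu mu))^2, which cancels the L^2 in T_k, and 2^S trades Delta0 for eps:
    this removes both from the leading term. *)
Lemma evals_le (eps : R) (N0 S : nat) :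
  let q := Num.sqrt (Lf pb / (nu pb * mu)) in
  let l := log2 (Num.max (Delta0 / eps) 1) in
  0 < eps -> N0%:R <= 7 * q -> 2 ^+ S <= 2 * (Delta0 / eps) -> S%:R <= 2 * l ->
  (grad_evals N0 S)%:R <= 14 * (q * l) /\
  (oracle_evals pb mu sigma Delta0 N0 S)%:R
    <= 4 * 7 ^+ 4 * (ns / (nu pb * mu * eps) + q * l).
Proof.
move=> q l e0 Nq S2 Sl.
have q0 : 0 <= q by exact: sqrtr_ge0.
have SN : S%:R * N0%:R <= 14 * (q * l).
  have := ler_pM (ler0n R S) (ler0n R N0) Sl Nq; lra.
split; first by rewrite grad_evalsE natrM.
apply: le_trans (oracle_evals_le N0 S) _.
have nm0 : 0 < nu pb * mu by rewrite mulr_gt0.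
have qq : q ^+ 2 = Lf pb / (nu pb * mu) by rewrite sqr_sqrtr// divr_ge0// ltW.
have N4 : N0%:R ^+ 4 <= 7 ^+ 4 * (Lf pb / (nu pb * mu)) ^+ 2.
  rewrite -qq -exprM -exprMn; apply: lerXn2r => //; rewrite nnegrE //.
  by rewrite mulr_ge0.
set B := ns * (nu pb * mu) / (Delta0 * Lf pb ^+ 2).
have B0 : 0 <= B.
  apply: divr_ge0; last by rewrite mulr_ge0 ?sqr_ge0// ltW.
  by apply: mulr_ge0 => //; exact: ltW.
have h1 : N0%:R ^+ 4 * B <= 7 ^+ 4 * (Lf pb / (nu pb * mu)) ^+ 2 * B by rewrite ler_wpM2r.
have h2 := ler_pM (mulr_ge0 (exprn_ge0 4 (ler0n R N0)) B0) (exprn_ge0 S (ler0n R 2)) h1 S2.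
set a := ns / (nu pb * mu * eps).
have a0 : 0 <= a by rewrite divr_ge0// mulr_ge0// ltW.
rewrite [X in _ <= X](_ : _ = 7 ^+ 4 * 2 * a) in h2; last first.
  by rewrite /B /a; move: (7 ^+ 4) => c; field; rewrite !gt_eqF.
rewrite (_ : N0%:R ^+ 4 * ns * (nu pb * mu) / _ = N0%:R ^+ 4 * B); last first.
  by rewrite /B !mulrA.
have ql0 : 0 <= q * l.
  by have := le_trans (mulr_ge0 (ler0n R S) (ler0n R N0)) SN; rewrite pmulr_rge0.
rewrite mulrDr; apply: lerD.
  move: h2; clearbody a; clear -a; move: (_ * B) (2 ^+ S) (7 ^+ 4) => x1 x2 x3; lra.
apply: le_trans SN _; apply: ler_wpM2r => //.
have : 1 <= 7 ^+ 3 :> R by apply: exprn_ege1; lra.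
rewrite [7 ^+ 4]exprS; move: (7 ^+ 3) => c; lra.
Qed.

End Complexity.

Theorem theorem3 (R : realType) :
  exists C1 C2 : R, 0 < C1 /\ 0 < C2 /\
  forall (n : nat) (pb : problem R n) (mu sigma Delta0 : R) (xs y0 : 'rV[R]_n)
    (dE : measure_display) (E : measurableType dE)
    (H : 'rV[R]_n -> E -> 'rV[R]_n)
    (d : measure_display) (Om : measurableType d) (P : probability Om R)
    (xi : nat -> nat -> nat -> Om -> E),
  let N0 := natceil (4 * Num.sqrt (2 * Lf pb / (nu pb * mu))) in
  let y (s : nat) (w : Om) :=
    msgs pb H mu sigma Delta0 N0 y0 (fun s k t => xi s k t w) s in
  let search (c : call) (w : Om) :=
    search_point pb H mu sigma Delta0 N0 y0 (fun s k t => xi s k t w)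
      c.1.1 c.1.2 c.2 in
  composite_problem pb ->
  is_argmin (feas pb) (Psi pb) xs ->
  prox_assumptions pb ->
  subproblems_solvable pb H ->
  0 < mu -> strongly_convex pb mu ->
  (forall x z, feas pb x -> feas pb z -> prox pb x z <= 1 / 2 * nrm pb (x - z) ^+ 2) ->
  feas pb y0 -> 0 < Delta0 -> Psi pb y0 - Psi pb xs <= Delta0 ->
  stochastic_oracle pb P [set c | is_call N0 (TT pb mu sigma Delta0 N0) c]
    H sigma (fun c => xi c.1.1 c.1.2 c.2) search ->
  (forall s : nat,
     ('E_P[fun w => (Psi pb (y s w) - Psi pb xs)%R] <= (Delta0 / 2 ^+ s)%:E)%E)
  /\
  (exists2 eps0 : R, 0 < eps0 & forall eps : R, 0 < eps -> eps <= eps0 ->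
     exists S : nat,
       [/\ stochastic_solution pb P xs eps (y S),
           (grad_evals N0 S)%:R
             <= C1 * (Num.sqrt (Lf pb / (nu pb * mu))
                      * log2 (Num.max (Delta0 / eps) 1)) &
           (oracle_evals pb mu sigma Delta0 N0 S)%:R
             <= C2 * ((Mh pb ^+ 2 + sigma ^+ 2) / (nu pb * mu * eps)
                      + Num.sqrt (Lf pb / (nu pb * mu))
                        * log2 (Num.max (Delta0 / eps) 1))]).
Proof.
exists 14, (4 * 7 ^+ 4); split; first by rewrite ltr0n.
split; first by rewrite mulr_gt0// exprn_gt0.
move=> n pb mu sigma Delta0 xs y0 dE E H d Om P xi N0 y search.
move=> HC Hxs HP HS mu0 Hmu HV Xy0 D0 gap HO.
have mean s := msgs_mean HC Hxs HP HS mu0 Hmu HV Xy0 D0 gap HO s.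
have Xy s w : feas pb (y s w) by exact: iterate_feas.
have Xxs : feas pb xs by case: Hxs.
have y_gap s w : 0 <= Psi pb (y s w) - Psi pb xs.
  by rewrite subr_ge0; case: Hxs => _; exact.
have Ey s : ('E_P[fun w => (Psi pb (y s w) - Psi pb xs)%R] <= (Delta0 / 2 ^+ s)%:E)%E.
  by apply: mean_le_expectation => [w|]; [exact: y_gap|exact: mean].
split=> //.
have L0 := Lf_gt0 HC; have nu0 := nu_gt0 HP.
have nm0 : 0 < nu pb * mu by rewrite mulr_gt0.
exists (Delta0 / 2) => [|eps e0 eD]; first by rewrite divr_gt0.
have [S [SE S2 Sl]] := phases_log2 e0 eD.
set q := Num.sqrt (Lf pb / _); set l := log2 _ in Sl *.
have [y0xs|y0xs] := eqVneq y0 xs.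
  (* Here [L / (nu mu)] may be arbitrarily small, but no phase is needed. *)
  exists 0%N.
  have l0 : 0 <= l by have := ler0n R S; lra.
  have q0 : 0 <= q by exact: sqrtr_ge0.
  rewrite grad_evalsE mul0n /oracle_evals big_geq//; split.
  - split; first exact: Xy.
    apply: mean_le_expectation => [w|]; first exact: y_gap.
    apply: mean_le_mono (mean_le_cst P eps) => // w.
    by rewrite /y /= y0xs subrr ltW.
  - by rewrite mulr_ge0// mulr_ge0.
  - apply: mulr_ge0; first by rewrite mulr_ge0// exprn_ge0.
    apply: addr_ge0; last exact: mulr_ge0.
    apply: divr_ge0; first by rewrite addr_ge0 ?sqr_ge0.
    by apply: mulr_ge0; exact: ltW.
have r0 : 0 < nrm pb (y0 - xs) ^+ 2.
  rewrite exprn_gt0// lt_neqAle (nrm_ge0 HC) andbT eq_sym; apply/eqP => r0.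
  have [_ _ /(_ _ r0)/eqP] := nrm_norm HC.
  by rewrite subr_eq0 (negbTE y0xs).
(* The points y0 and xs are distinct, so the two quadratic bounds on f compare mu with L, and those
   on V compare nu with 1. *)
have muL : mu <= Lf pb.
  have := Hmu _ _ Xy0 Xxs; have := ff_smooth HC Xy0 Xxs => h1 h2.
  rewrite -(ler_pM2r r0); lra.
have nu1 : nu pb <= 1.
  have := prox_lower HC HP Xy0 Xxs; have := HV _ _ Xy0 Xxs => h1 h2.
  rewrite -(ler_pM2r r0); lra.
have q1 : 1 <= q.
  have h : 1 <= Lf pb / (nu pb * mu).
    by rewrite ler_pdivlMr// mul1r (le_trans _ muL)// ler_piMl// ltW.
  by have := ler_wsqrtr h; rewrite sqrtr1.
have Nq : N0%:R <= 7 * q.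
  have a0 : 0 <= 2 * Lf pb / (nu pb * mu) by rewrite divr_ge0 ?mulr_ge0// ltW.
  (* 3 / 2 replaces the square root of 2; then 4 times 3 / 2, plus 1 for the ceiling with q >= 1,
     gives 7. *)
  have h : Num.sqrt (2 * Lf pb / (nu pb * mu)) <= 3 / 2 * q.
    rewrite -[leRHS]ger0_norm; last by lra.
    rewrite -sqrtr_sqr ler_sqrt; last exact: sqr_ge0.
    rewrite exprMn sqr_sqrtr; last by rewrite divr_ge0// ltW.
    have : 0 < Lf pb / (nu pb * mu) by rewrite divr_gt0.
    lra.
  apply: le_trans (ltW (natceil_lt _)) _; last by lra.
  by rewrite mulr_ge0// sqrtr_ge0.
have [h1 h2] := evals_le sigma L0 nu0 mu0 D0 e0 Nq S2 Sl.
exists S; split=> //; split; first exact: Xy.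
by apply: le_trans (Ey S) _; rewrite lee_fin.
Qed.
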